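(* Let $(M, g(t))$, $t\in [0, T]$, be a solution to the Ricci flow $\frac{\partial g_{ij}}{\partial t} = -2R_{ij}$ on a closed manifold $M$ with nonnegative curvature operator. Let $f$ be a positive solution on $M\times[0,T]$, with $f<1$, of the backward heat equation $$\frac{\partial f}{\partial t} = -\triangle_{g(t)} f.$$ Let $u=-\ln f$, $\tau=T-t$ and $$H=|\nabla u|^2-\frac{u}{\tau}.$$ Then for all time $t\in[0,T)$, $H\le 0$ on $M$, i.e., $$|\nabla f|^2 \le \frac{f^2 \ln (1/f)}{T-t}.$$
   Context: All geometric quantities are taken with respect to the evolving metric $g(t)$: $R_{ij}$ is the Ricci curvature, $\nabla$ the Levi-Civita connection, $\triangle=\triangle_{g(t)}$ the Laplace-Beltrami operator (trace of the Hessian), and $|\cdot|$ the norm of $g(t)$; $g(t)$ has nonnegative curvature operator for all $t$. Solutions are smooth. ''Closed'' means compact without boundary. *)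

(* Defs.v *)
From mathcomp Require Import all_boot all_order all_algebra.
From mathcomp Require Import all_classical all_reals all_analysis.
Set Implicit Arguments.
Unset Strict Implicit.
Unset Printing Implicit Defensive.
Import Order.TTheory GRing.Theory Num.Theory.
Import numFieldNormedType.Exports.
Local Open Scope classical_set_scope.
Local Open Scope ring_scope.

Section Smooth.
Variables (R : realType) (E : normedModType R).

Definition iter_derive (vs : seq E) (F : E -> R) : E -> R :=
  foldr (fun v G => 'D_v G : E -> R) F vs.

(* For finite-dimensional E and open U this is C^infinity: every iterated
   directional derivative is differentiable, hence continuous, on U. *)
Definition smooth_on (U : set E) (F : E -> R) : Prop :=
  forall (vs : seq E) (z : E), U z -> differentiable (iter_derive vs F) z.

(* Smoothness on an arbitrary subset (here a product of a closed time interval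
   with an open set): locally the restriction of a smooth function. *)
Definition smooth_within (A : set E) (F : E -> R) : Prop :=
  forall z, A z -> exists (U : set E) (G : E -> R),
    [/\ open U, U z, smooth_on U G & forall y, A y -> U y -> F y = G y].

End Smooth.

(* Limit of difference quotients along A; one-sided at an end of an interval. *)
Definition is_derive_within (R : realType) (A : set R) (F : R -> R) (t l : R)
    : Prop :=
  (F s - F t) / (s - t) @[s --> within A t^'] --> l.

Definition partial (R : realType) (n : nat) (i : 'I_n) (F : 'rV[R]_n -> R)
    (x : 'rV[R]_n) : R :=
  'D_(delta_mx 0 i) F x.

(* Each chart is a homeomorphism of the open set dom c of M onto the open set
   cod c of R^n, with inverse point c; the values of coord c outside dom c and
   of point c outside cod c are irrelevant. There is no boundary, since charts
   are modelled on open subsets of R^n. *)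
Record smooth_atlas (R : realType) (n : nat) (M : topologicalType) := SmoothAtlas {
  chart : Type;
  dom : chart -> set M;
  cod : chart -> set 'rV[R]_n;
  coord : chart -> M -> 'rV[R]_n;
  point : chart -> 'rV[R]_n -> M;
  dom_open : forall c, open (dom c);
  cod_open : forall c, open (cod c);
  coord_cod : forall c p, dom c p -> cod c (coord c p);
  point_dom : forall c x, cod c x -> dom c (point c x);
  coordK : forall c p, dom c p -> point c (coord c p) = p;
  pointK : forall c x, cod c x -> coord c (point c x) = x;
  coord_continuous : forall c p, dom c p -> {for p, continuous (coord c)};
  point_continuous : forall c x, cod c x -> {for x, continuous (point c)};
  dom_cover : forall p, exists c, dom c p;
  transition_smooth : forall (a b : chart) (k : 'I_n),
    smooth_on (cod a `&` point a @^-1` dom b)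
              (fun x => coord b (point a x) 0 k)
}.

(* Geometry of a metric G = (g_ij) given on an open subset of R^n. *)
Section LocalGeometry.
Variables (R : realType) (n : nat) (G : 'rV[R]_n -> 'M[R]_n).
Implicit Types (x : 'rV[R]_n) (i j k l m : 'I_n) (h : 'rV[R]_n -> R).

(* Gamma^k_ij *)
Definition christoffel k i j x : R :=
  2^-1 * \sum_l invmx (G x) k l *
    (partial i (fun y => G y j l) x + partial j (fun y => G y i l) x
     - partial l (fun y => G y i j) x).

(* The d_l-component of R(d_i, d_j) d_k, where
   R(X, Y) = nabla_X nabla_Y - nabla_Y nabla_X - nabla_[X,Y]. *)
Definition riemann i j k l x : R :=
  partial i (christoffel l j k) x - partial j (christoffel l i k) x
  + \sum_m (christoffel l i m x * christoffel m j k x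
            - christoffel l j m x * christoffel m i k x).

(* <R(d_i, d_j) d_k, d_l>, so that a round sphere has riemann_low i j j i > 0
   for i != j in orthogonal coordinates. *)
Definition riemann_low i j k l x : R :=
  \sum_m G x l m * riemann i j k m x.

(* Ric(d_j, d_k) is the trace of X |-> R(X, d_j) d_k. *)
Definition ricci j k x : R := \sum_i riemann i j k i x.

(* The curvature operator as a symmetric bilinear form on 2-vectors, with
   X /\ Y, Z /\ W |-> <R(X, Y) W, Z>. An antisymmetric matrix w stands for the
   2-vector (1/2) sum_ij w_ij d_i /\ d_j. *)
Definition curvature_operator x (w v : 'M[R]_n) : R :=
  4^-1 * \sum_i \sum_j \sum_k \sum_l w i j * v k l * riemann_low i j l k x.

Definition gradient h x : 'rV[R]_n :=
  \row_i \sum_j invmx (G x) i j * partial j h x.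

Definition normsq x (v : 'rV[R]_n) : R := \sum_i \sum_j G x i j * v 0 i * v 0 j.

Definition hessian h i j x : R :=
  partial i (partial j h) x - \sum_k christoffel k i j x * partial k h x.

Definition laplacian h x : R :=
  \sum_i \sum_j invmx (G x) i j * hessian h i j x.

End LocalGeometry.

Section OnManifold.
Variables (R : realType) (n : nat) (M : topologicalType).
Variable A : smooth_atlas R n M.

(* The components g_ij of a covariant 2-tensor field in every chart c, as
   functions of the coordinates; only the values on cod c matter. *)
Definition tensor2 : Type := chart A -> 'rV[R]_n -> 'M[R]_n.

(* Smoothness is not included: it is required jointly in space and time by
   smooth_metric_family. *)
Definition riemannian_metric (g : tensor2) : Prop :=
  [/\ forall c x, cod c x -> (g c x)^T = g c x,
      forall c x (v : 'rV[R]_n), cod c x -> v != 0 ->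
        0 < (v *m g c x *m v^T) 0 0
    & forall (a b : chart A) x (i j : 'I_n), cod a x -> dom b (point a x) ->
        let phi y := coord b (point a y) in
        g a x i j = \sum_k \sum_l
          partial i (fun y => phi y 0 k) x * partial j (fun y => phi y 0 l) x
          * g b (phi x) k l].

(* w ranges over the component matrices of all 2-vectors at a point. *)
Definition nonneg_curvature_operator (g : tensor2) : Prop :=
  forall c x (w : 'M[R]_n), cod c x -> w^T = - w ->
    0 <= curvature_operator (g c) x w w.

Definition time_space (I : set R) (c : chart A) : set (R^o * 'rV[R]_n)%type :=
  [set z | I z.1 /\ cod c z.2].

Definition smooth_metric_family (I : set R) (g : R -> tensor2) : Prop :=
  (forall t, I t -> riemannian_metric (g t)) /\
  (forall c (i j : 'I_n),
     smooth_within (time_space I c) (fun z => g z.1 c z.2 i j)).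

Definition smooth_function_family (I : set R) (f : R -> M -> R) : Prop :=
  forall c, smooth_within (time_space I c) (fun z => f z.1 (point c z.2)).

Definition ricci_flow (I : set R) (g : R -> tensor2) : Prop :=
  forall t c x (i j : 'I_n), I t -> cod c x ->
    is_derive_within I (fun s => g s c x i j) t (- 2 * ricci (g t c) i j x).

(* Laplacian and squared gradient norm of h : M -> R at p, computed in the
   chart c; they do not depend on the choice of c with dom c p. *)
Definition laplacian_at (g : tensor2) c (h : M -> R) (p : M) : R :=
  laplacian (g c) (h \o point c) (coord c p).

Definition grad_normsq_at (g : tensor2) c (h : M -> R) (p : M) : R :=
  normsq (g c) (coord c p) (gradient (g c) (h \o point c) (coord c p)).

Definition backward_heat_equation (I : set R) (g : R -> tensor2)
    (f : R -> M -> R) : Prop :=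
  forall t c p, I t -> dom c p ->
    is_derive_within I (fun s => f s p) t (- laplacian_at (g t) c (f t) p).

End OnManifold.

(* Main.v *)
Require Import Defs.
From mathcomp Require Import all_boot all_order all_algebra.
From mathcomp Require Import ring lra.
From mathcomp Require Import all_classical all_reals all_analysis.
Import Order.TTheory GRing.Theory Num.Theory.
Import numFieldNormedType.Exports.
Local Open Scope classical_set_scope.
Local Open Scope ring_scope.
Set Implicit Arguments.
Unset Strict Implicit.
Unset Printing Implicit Defensive.

(** The estimate is a maximum principle for psi = tau |grad u|^2 - u, where
    u = - ln f and tau = T - t; the claim H <= 0 is psi <= 0 divided by tau.

    The heat equation for f becomes du/dt = |grad u|^2 - Lap u
    ([nlog_evolution]).  Under the Ricci flow the inverse metric has time
    derivative 2 Ric with both indices raised, so |grad u|^2 has time derivative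
    2 Ric(grad u, grad u) + 2 <grad u, grad (|grad u|^2 - Lap u)>
    ([sqnorm_evolution]).  Adding the Bochner formula ([bochner])
      Lap |grad u|^2 = 2 |Hess u|^2 + 2 <grad u, grad Lap u> + 2 Ric(grad u, grad u)
    cancels the third derivatives of u and leaves
      (d/dt + Lap) psi
        = 2 <grad u, grad psi> + tau (4 Ric(grad u, grad u) + 2 |Hess u|^2).
    A nonnegative curvature operator makes Ric nonnegative ([ricci_ge0]), so the
    last term is nonnegative.  At a maximum of psi + e (t - T), with e > 0, that
    is attained before time T, the gradient of psi vanishes, Lap psi <= 0 and
    d psi/dt <= - e, which is contradictory ([harnack_no_max]).  Hence the maximum
    over the compact space-time is attained at time T, where psi = - u < 0, and
    e tends to 0.

    The computations are made in the coordinates of an arbitrary chart.  The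
    Christoffel symbols are arranged as matrices C_i with (C_i)_(j, k) = Gamma^k_ij;
    then metric compatibility, the curvature, its skew-symmetry and the Ricci
    identity are identities between matrix products, obtained by differentiating
    matrix-valued functions and using that partial derivatives commute
    ([derive_comm]).  Every inequality between quadratic forms (|Hess u|^2 >= 0,
    Ric >= 0, Lap <= 0 at a maximum) is the statement that the trace of the
    product of a positive definite and a positive semidefinite matrix is
    nonnegative ([trace_mul_ge0]).

    At the ends of the time interval the data are restrictions of smooth functions.
    Sums, products, inverses, logarithms and space derivatives of such restrictions
    are again of this kind, and their one-sided time derivatives commute with the
    space derivatives ([time_space_derive_comm]). *)

(** * Calculus of smooth functions *)

Section SmoothCalculus.
Variables (R : realType) (E : normedModType R).
Implicit Types (U V A : set E) (F G : E -> R) (z v w : E).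

(** Smoothness stratified by the order of differentiation.  Closure under
    products is an induction on this order, which the list of directions in
    [smooth_on] does not support: differentiating a product gives a sum of
    products, with different factors. *)
Fixpoint diff_upto k U F : Prop :=
  if k is k'.+1
  then (forall z, U z -> differentiable F z) /\
       forall v, diff_upto k' U ('D_v F : E -> R)
  else forall z, U z -> differentiable F z.

Lemma diff_uptoW k U F : diff_upto k.+1 U F -> diff_upto k U F.
Proof.
elim: k F => [|k IH] F /=; first by case.
by case=> dF dDF; split => // v; apply: IH.
Qed.

Lemma smooth_onP U F : smooth_on U F <-> forall k, diff_upto k U F.
Proof.
split=> [sF k|sF vs z Uz].
  elim: k F sF => [|k IH] F sF /=; first by move=> z; exact: (sF [::]).
  split=> [z|v]; first exact: (sF [::]).
  apply: IH => vs z Uz; have := sF (rcons vs v) z Uz.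
  by rewrite /iter_derive foldr_rcons.
elim/last_ind: vs F sF => [|vs v IH] F sF; first exact: (sF 0%N).
rewrite /iter_derive foldr_rcons; apply: IH => k.
have [_] := sF k.+1; exact.
Qed.

Lemma smooth_on_differentiable U F z : smooth_on U F -> U z -> differentiable F z.
Proof. by move=> sF; exact: (sF [::]). Qed.

Lemma smooth_on_derivable U F z v : smooth_on U F -> U z -> derivable F z v.
Proof. by move=> sF Uz; apply/diff_derivable/(smooth_on_differentiable sF). Qed.

Lemma smooth_on_continuous U F z : smooth_on U F -> U z -> {for z, continuous F}.
Proof. by move=> sF Uz; apply/differentiable_continuous/(smooth_on_differentiable sF). Qed.

Lemma smooth_on_derive U F v : smooth_on U F -> smooth_on U ('D_v F).
Proof. move=> /smooth_onP sF; apply/smooth_onP => k; have [_] := sF k.+1; exact. Qed.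

Lemma smooth_on_sub U V F : V `<=` U -> smooth_on U F -> smooth_on V F.
Proof. by move=> VU sF vs z /VU; exact: sF. Qed.

Lemma derive_eq_on U F G v z : open U -> (forall y, U y -> F y = G y) -> U z ->
  'D_v F z = 'D_v G z.
Proof.
move=> oU FG Uz; apply: near_eq_derive; near=> y; apply: FG; near: y.
exact: open_nbhs_nbhs.
Unshelve. all: by end_near. Qed.

Lemma near_eq_differentiable F G z :
  (\near z, F z = G z) -> differentiable F z -> differentiable G z.
Proof.
move=> FG /diff_locallyP[dc eF].
have Fz : F z = G z := nbhs_singleton FG.
have eG : G \o shift z = cst (G z) + 'd F z +o_ 0 id.
  have FG0 : \forall h \near 0, F (h + z) = G (h + z).
    by move: FG; rewrite (near_shift 0) subr0.
  apply/eqaddoP => e e0; move/eqaddoP/(_ e e0): eF => eF.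
  apply: filterS2 FG0 eF => h FGh.
  by rewrite -![(_ - _ : _ -> _) _]/(_ - _) /= /cst -Fz FGh.
by apply/diff_locallyP; rewrite (diff_unique dc eG).
Unshelve. all: by end_near. Qed.

Lemma diff_upto_eq k U F G : open U -> (forall y, U y -> F y = G y) ->
  diff_upto k U F -> diff_upto k U G.
Proof.
move=> oU; elim: k F G => [|k IH] F G FG /=.
  move=> dF z Uz; apply: near_eq_differentiable (dF z Uz).
  by near=> y; apply: FG; near: y; exact: open_nbhs_nbhs.
case=> dF DF; split=> [z Uz|v].
  apply: near_eq_differentiable (dF z Uz).
  by near=> y; apply: FG; near: y; exact: open_nbhs_nbhs.
apply: IH (DF v) => y Uy; exact: derive_eq_on Uy.
Unshelve. all: by end_near. Qed.

Lemma smooth_on_eq U F G : open U -> (forall y, U y -> F y = G y) ->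
  smooth_on U F -> smooth_on U G.
Proof.
move=> oU FG /smooth_onP sF; apply/smooth_onP => k.
exact: diff_upto_eq (sF k).
Qed.

Lemma diff_uptoD k U F G : open U -> diff_upto k U F -> diff_upto k U G ->
  diff_upto k U (F \+ G).
Proof.
move=> oU; elim: k F G => [|k IH] F G /=.
  by move=> dF dG z Uz; apply: differentiableD; [exact: dF|exact: dG].
move=> [dF DF] [dG DG]; split=> [z Uz|v].
  by apply: differentiableD; [exact: dF|exact: dG].
apply: diff_upto_eq (IH _ _ (DF v) (DG v)) => // y Uy /=.
by apply/esym/deriveD; apply/diff_derivable; [exact: dF|exact: dG].
Qed.

Lemma diff_uptoM k U F G : open U -> diff_upto k U F -> diff_upto k U G ->
  diff_upto k U (F \* G).
Proof.
move=> oU; elim: k F G => [|k IH] F G.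
  by move=> dF dG z Uz; apply: differentiableM; [exact: dF|exact: dG].
move=> dF dG; have [dF0 DF] := dF; have [dG0 DG] := dG; split=> [z Uz|v].
  by apply: differentiableM; [exact: dF0|exact: dG0].
apply: diff_upto_eq (diff_uptoD oU (IH _ _ (diff_uptoW dF) (DG v))
  (IH _ _ (diff_uptoW dG) (DF v))) => // y Uy /=.
by apply/esym/deriveM; apply/diff_derivable; [exact: dF0|exact: dG0].
Qed.

Lemma smooth_on_cst U c : smooth_on U (fun=> c : R).
Proof.
apply/smooth_onP => k; elim: k c => [|k IH] c /=.
  by move=> z _; exact: differentiable_cst.
split=> [z _|v]; first exact: differentiable_cst.
rewrite (_ : 'D_v _ = fun=> 0 : R) //.
by apply/funext => z; exact: derive_cst.
Qed.

Lemma smooth_onD U F G : open U -> smooth_on U F -> smooth_on U G ->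
  smooth_on U (fun z => F z + G z).
Proof.
by move=> oU /smooth_onP sF /smooth_onP sG; apply/smooth_onP => k; exact: diff_uptoD.
Qed.

Lemma smooth_onM U F G : open U -> smooth_on U F -> smooth_on U G ->
  smooth_on U (fun z => F z * G z).
Proof.
by move=> oU /smooth_onP sF /smooth_onP sG; apply/smooth_onP => k; exact: diff_uptoM.
Qed.

Lemma smooth_onN U F : open U -> smooth_on U F -> smooth_on U (fun z => - F z).
Proof.
move=> oU sF; have := smooth_onM oU (@smooth_on_cst U (-1)) sF.
by apply: smooth_on_eq => // y _; rewrite mulN1r.
Qed.

Lemma smooth_onV U F : open U -> (forall z, U z -> F z != 0) -> smooth_on U F ->
  smooth_on U (fun z => (F z)^-1).
Proof.
move=> oU F0 sF.
have dV z : U z -> differentiable (fun y => (F y)^-1) z.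
  by move=> Uz; apply: differentiableV; [exact: smooth_on_differentiable Uz|exact: F0].
apply/smooth_onP; elim=> [|k IH]; first exact: dV.
split=> // v.
have /smooth_onP/(_ k) DF := smooth_onN oU (smooth_on_derive v sF).
apply: diff_upto_eq (diff_uptoM oU DF (diff_uptoM oU IH IH)) => // y Uy /=.
rewrite deriveV ?F0//; last exact: smooth_on_derivable Uy.
by rewrite -invfM scaleNr -[_ *: _]/(_ * _) mulNr mulrC.
Qed.

Lemma derive_ln F z v : differentiable F z -> 0 < F z ->
  'D_v (fun y => ln (F y)) z = 'D_v F z / F z.
Proof.
move=> dF F0.
have dln : differentiable (@ln R) (F z).
  by apply/derivable1_diffP; have [] := is_derive1_ln F0.
have dl : differentiable (fun y => ln (F y)) z by exact: differentiable_comp.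
rewrite !deriveE//.
rewrite (_ : (fun y => ln (F y)) = (@ln R) \o F) // (diff_comp dF dln).
rewrite /= deriv1E; last by have [] := is_derive1_ln F0.
by rewrite derive1E; have [_ ->] := is_derive1_ln F0.
Qed.

Lemma smooth_on_ln U F : open U -> (forall z, U z -> 0 < F z) -> smooth_on U F ->
  smooth_on U (fun z => ln (F z)).
Proof.
move=> oU F0 sF.
have Fn0 z : U z -> F z != 0 by move=> /F0/lt0r_neq0.
have dl z : U z -> differentiable (fun y => ln (F y)) z.
  move=> Uz; apply: differentiable_comp; first exact: smooth_on_differentiable Uz.
  by apply/derivable1_diffP; have [] := is_derive1_ln (F0 z Uz).
apply/smooth_onP; case=> [|k]; first exact: dl.
split=> // v.
have /smooth_onP/(_ k) := smooth_onM oU (smooth_on_derive v sF) (smooth_onV oU Fn0 sF).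
apply: diff_upto_eq => // y Uy; rewrite derive_ln//; last exact: F0.
exact: smooth_on_differentiable sF Uy.
Qed.

End SmoothCalculus.

Section SmoothWithin.
Variables (R : realType) (E : normedModType R).
Implicit Types (U V A : set E) (F G : E -> R) (z v w : E).

Lemma smooth_within_open A F : open A -> smooth_within A F <-> smooth_on A F.
Proof.
move=> oA; split=> [sF vs z Az|sF z Az]; last by exists A, F.
have [U [G [oU Uz sG FG]]] := sF z Az.
have oAU : open (A `&` U) by exact: openI.
apply: (@smooth_on_eq _ _ (A `&` U) G F) => //.
  by move=> y [Ay Uy]; rewrite FG.
by apply: smooth_on_sub sG => y [].
Qed.

Lemma smooth_within_eq A F G : (forall y, A y -> F y = G y) ->
  smooth_within A F -> smooth_within A G.
Proof.
move=> FG sF z Az; have [U [K [oU Uz sK FK]]] := sF z Az.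
by exists U, K; split=> // y Ay Uy; rewrite -FG// FK.
Qed.

Lemma smooth_within_cst A (c : R) : smooth_within A (fun=> c).
Proof.
by move=> z _; exists setT, (fun=> c); split=> //; [exact: openT|exact: smooth_on_cst].
Qed.

Lemma smooth_withinD A F G : smooth_within A F -> smooth_within A G ->
  smooth_within A (fun z => F z + G z).
Proof.
move=> sF sG z Az; have [U [K [oU Uz sK FK]]] := sF z Az.
have [V [L [oV Vz sL GL]]] := sG z Az.
exists (U `&` V), (fun z => K z + L z); split=> //; first exact: openI.
  apply: smooth_onD; first exact: openI.
    by apply: smooth_on_sub sK => y [].
  by apply: smooth_on_sub sL => y [].
by move=> y Ay [Uy Vy]; rewrite FK// GL.
Qed.

Lemma smooth_withinM A F G : smooth_within A F -> smooth_within A G ->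
  smooth_within A (fun z => F z * G z).
Proof.
move=> sF sG z Az; have [U [K [oU Uz sK FK]]] := sF z Az.
have [V [L [oV Vz sL GL]]] := sG z Az.
exists (U `&` V), (fun z => K z * L z); split=> //; first exact: openI.
  apply: smooth_onM; first exact: openI.
    by apply: smooth_on_sub sK => y [].
  by apply: smooth_on_sub sL => y [].
by move=> y Ay [Uy Vy]; rewrite FK// GL.
Qed.

Lemma smooth_withinN A F : smooth_within A F -> smooth_within A (fun z => - F z).
Proof.
move=> /(smooth_withinM (@smooth_within_cst A (-1))).
by apply: smooth_within_eq => y _; rewrite mulN1r.
Qed.

(** The smooth extension may be cut down to where it stays in an open set of
    values, so that it can be inverted or its logarithm taken. *)
Lemma smooth_within_shrink A F (P : set R) : open P ->
  (forall z, A z -> P (F z)) -> smooth_within A F ->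
  forall z, A z -> exists (U : set E) (G : E -> R),
    [/\ open U, U z, smooth_on U G, forall y, A y -> U y -> F y = G y
      & forall y, U y -> P (G y)].
Proof.
move=> oP PF sF z Az; have [U [G [oU Uz sG FG]]] := sF z Az.
have ctG y : U y -> {for y, continuous G} by exact: smooth_on_continuous.
exists (U `&` G @^-1` P), G; split.
- rewrite openE => y [Uy Py]; apply: filterI; first exact: open_nbhs_nbhs.
  by apply: ctG => //; exact: open_nbhs_nbhs.
- by split=> //=; rewrite -FG//; exact: PF.
- by apply: smooth_on_sub sG => y [].
- by move=> y Ay [Uy _]; exact: FG.
- by move=> y [].
Qed.

Lemma smooth_withinV A F : (forall z, A z -> F z != 0) -> smooth_within A F ->
  smooth_within A (fun z => (F z)^-1).
Proof.
move=> F0 sF z Az.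
have oP : open [set x : R | x != 0].
  rewrite (_ : [set x | _] = ~` [set 0]); last by apply/seteqP; split=> x /= /eqP.
  by rewrite openC; apply/accessible_closed_set1/hausdorff_accessible.
have [U [G [oU Uz sG FG G0]]] := smooth_within_shrink oP F0 sF Az.
exists U, (fun z => (G z)^-1); split=> //; first exact: smooth_onV.
by move=> y Ay Uy; rewrite FG.
Qed.

Lemma smooth_within_ln A F : (forall z, A z -> 0 < F z) -> smooth_within A F ->
  smooth_within A (fun z => ln (F z)).
Proof.
move=> F0 sF z Az.
have [U [G [oU Uz sG FG G0]]] := smooth_within_shrink (@open_gt R 0) F0 sF Az.
exists U, (fun z => ln (G z)); split=> //; first exact: smooth_on_ln.
by move=> y Ay Uy; rewrite FG.
Qed.

Lemma smooth_within_sum A (I : Type) (r : seq I) (P : pred I) (F : I -> E -> R) :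
  (forall i, P i -> smooth_within A (F i)) ->
  smooth_within A (fun z => \sum_(i <- r | P i) F i z).
Proof.
move=> sF; elim: r => [|i r IH].
  by apply: smooth_within_eq (@smooth_within_cst A 0) => y _; rewrite big_nil.
have [Pi|Pi] := boolP (P i); last first.
  by apply: smooth_within_eq IH => y _; rewrite big_cons (negbTE Pi).
by apply: smooth_within_eq (smooth_withinD (sF i Pi) IH) => y _; rewrite big_cons Pi.
Qed.

Lemma smooth_within_prod A (I : Type) (r : seq I) (P : pred I) (F : I -> E -> R) :
  (forall i, P i -> smooth_within A (F i)) ->
  smooth_within A (fun z => \prod_(i <- r | P i) F i z).
Proof.
move=> sF; elim: r => [|i r IH].
  by apply: smooth_within_eq (@smooth_within_cst A 1) => y _; rewrite big_nil.
have [Pi|Pi] := boolP (P i); last first.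
  by apply: smooth_within_eq IH => y _; rewrite big_cons (negbTE Pi).
by apply: smooth_within_eq (smooth_withinM (sF i Pi) IH) => y _; rewrite big_cons Pi.
Qed.

Lemma smooth_within_det A n (B : E -> 'M[R]_n) :
  (forall i j, smooth_within A (fun z => B z i j)) ->
  smooth_within A (fun z => \det (B z)).
Proof.
move=> sB; apply: smooth_within_sum => s _; apply: smooth_withinM.
  exact: smooth_within_cst.
by apply: smooth_within_prod => i _; exact: sB.
Qed.

(** The entries of the inverse are cofactors over the determinant, hence rational
    in the entries of the matrix. *)
Lemma smooth_within_invmx A n (B : E -> 'M[R]_n) :
  (forall z, A z -> B z \in unitmx) ->
  (forall i j, smooth_within A (fun z => B z i j)) ->
  forall i j, smooth_within A (fun z => invmx (B z) i j).
Proof.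
move=> uB sB i j.
have sc : smooth_within A (fun z => cofactor (B z) j i).
  apply: smooth_withinM; first exact: smooth_within_cst.
  apply: smooth_within_det => k l.
  by apply: smooth_within_eq (sB (lift j k) (lift i l)) => z _; rewrite !mxE.
have sd : smooth_within A (fun z => (\det (B z))^-1).
  apply: smooth_withinV; last exact: smooth_within_det.
  by move=> z /uB; rewrite unitmxE unitfE.
apply: smooth_within_eq (smooth_withinM sd sc) => z Az.
by rewrite /invmx (uB z Az) !mxE.
Qed.

Lemma smooth_within_continuous A F z : smooth_within A F -> A z ->
  F y @[y --> within A (nbhs z)] --> F z.
Proof.
move=> sF Az; have [U [G [oU Uz sG FG]]] := sF z Az.
have Gz : G y @[y --> within A (nbhs z)] --> F z.
  rewrite FG//; apply: cvg_within_filter; exact: smooth_on_continuous Uz.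
apply: cvg_trans Gz; apply: near_eq_cvg; rewrite near_withinE; near=> y => Ay.
by rewrite FG//; near: y; exact: open_nbhs_nbhs.
Unshelve. all: by end_near. Qed.

End SmoothWithin.

Section SmoothOnAlgebra.
Variables (R : realType) (E : normedModType R) (U : set E).
Hypothesis oU : open U.

Lemma smooth_on_sum (I : Type) (r : seq I) (P : pred I) (F : I -> E -> R) :
  (forall i, P i -> smooth_on U (F i)) ->
  smooth_on U (fun z => \sum_(i <- r | P i) F i z).
Proof.
move=> sF; apply/smooth_within_open => //; apply: smooth_within_sum => i Pi.
by apply/smooth_within_open => //; exact: sF.
Qed.

Lemma smooth_on_invmx n (B : E -> 'M[R]_n) :
  (forall z, U z -> B z \in unitmx) ->
  (forall i j, smooth_on U (fun z => B z i j)) ->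
  forall i j, smooth_on U (fun z => invmx (B z) i j).
Proof.
move=> uB sB i j; apply/smooth_within_open => //.
by apply: smooth_within_invmx => // k l; apply/smooth_within_open.
Qed.

End SmoothOnAlgebra.

(** * Mixed derivatives and the second derivative test *)

Section Lines.
Variables (R : realType) (E : normedModType R).
Implicit Types (U : set E) (F : E -> R) (z v w : E).

Lemma is_derive_line F z v (r : R) : differentiable F (z + r *: v) ->
  is_derive r 1 (fun s : R => F (z + s *: v)) ('D_v F (z + r *: v)).
Proof.
move=> dF.
have dl : is_diff r (fun s : R => z + s *: v) (fun s : R => s *: v).
  rewrite (_ : (fun s : R => s *: v) = 0 + ( *:%R^~ v)).
    exact: is_diffD.
  by apply/funext => s /=; rewrite -[RHS]/(0 + s *: v) add0r.
have dFl : differentiable (F \o (fun s : R => z + s *: v)) r.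
  by apply: differentiable_comp => //; exact: ex_diff.
apply: DeriveDef; first exact: diff_derivable.
by rewrite !deriveE// diff_comp//= diff_val scale1r.
Qed.

Lemma mvt_line U F z v (s : R) : smooth_on U F ->
  0 < s -> (forall r, 0 <= r <= s -> U (z + r *: v)) ->
  exists2 c, 0 < c < s & F (z + s *: v) - F z = s * 'D_v F (z + c *: v).
Proof.
move=> sF s0 Us.
have dF r : 0 <= r <= s ->
    is_derive r 1 (fun s : R => F (z + s *: v)) ('D_v F (z + r *: v)).
  by move=> rs; apply: is_derive_line; apply: smooth_on_differentiable sF _; exact: Us.
have [| |c] := @MVT R (fun s : R => F (z + s *: v)) (fun r => 'D_v F (z + r *: v)) 0 s s0.
- by move=> x; rewrite in_itv/= => /andP[x0 xs]; apply: dF; rewrite !ltW.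
- apply: derivable_within_continuous => x; rewrite in_itv/= => xs.
  by have [] := dF x xs.
by rewrite in_itv/= subr0 scale0r addr0 => cs ->; exists c => //; rewrite mulrC.
Qed.

Lemma near_plane (P : set E) z v w : nbhs z P ->
  exists2 e : R, 0 < e &
    forall c d, 0 <= c <= e -> 0 <= d <= e -> P (z + c *: v + d *: w).
Proof.
move=> /nbhs_ballP[r /= r0 rP].
pose m := `|v| + `|w| + 1.
have m0 : 0 < m by rewrite /m ltr_wpDl// addr_ge0.
exists (r / (2 * m)); first by rewrite divr_gt0// mulr_gt0.
move=> c d /andP[c0 ce] /andP[d0 de]; apply: rP.
rewrite -ball_normE /= -addrA opprD addNKr normrN.
apply: (@le_lt_trans _ _ (r / (2 * m) * (`|v| + `|w|))).
  rewrite mulrDr (le_trans (ler_normD _ _))// !normrZ !ger0_norm//.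
  by rewrite lerD// ler_wpM2r.
apply: (@le_lt_trans _ _ (r / (2 * m) * m)).
  by rewrite ler_wpM2l ?divr_ge0 ?ltW// ?mulr_gt0// /m ltrDl.
have -> : r / (2 * m) * m = r / 2 by field; rewrite gt_eqF.
by rewrite ltr_pdivrMr// ltr_pMr// ltr1n.
Qed.

(** Both mixed derivatives are limits of the same second difference over a
    small parallelogram, by two applications of the mean value theorem. *)
Lemma derive_comm U F z v w : open U -> smooth_on U F -> U z ->
  'D_v ('D_w F) z = 'D_w ('D_v F) z.
Proof.
move=> oU sF Uz.
(* The second difference over the parallelogram with sides s v' and s w'. *)
have key v' w' (s : R) : 0 < s ->
    (forall c d, 0 <= c <= s -> 0 <= d <= s -> U (z + c *: v' + d *: w')) ->
    exists c d, [/\ 0 <= c <= s, 0 <= d <= s &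
     F (z + s *: v' + s *: w') - F (z + s *: v') - (F (z + s *: w') - F z)
     = s * (s * 'D_w' ('D_v' F) (z + c *: v' + d *: w'))].
  move=> s0 Us.
  have ss : 0 <= s <= s by rewrite ltW/=.
  have dF r : 0 <= r <= s -> is_derive r 1
     (fun r : R => F ((z + s *: w') + r *: v') - F (z + r *: v'))
     ('D_v' F (z + s *: w' + r *: v') - 'D_v' F (z + r *: v')).
    move=> rs; apply: is_deriveB; apply: is_derive_line;
      apply: smooth_on_differentiable sF _.
      by rewrite addrAC; apply: Us.
    by have := Us r 0 rs; rewrite scale0r addr0; apply; rewrite lexx ltW.
  have [| |c] := @MVT R
    (fun r : R => F ((z + s *: w') + r *: v') - F (z + r *: v'))
    (fun r => 'D_v' F (z + s *: w' + r *: v') - 'D_v' F (z + r *: v')) 0 s s0.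
  - move=> x; rewrite in_itv/= => /andP[x0 xs].
    by apply: dF; rewrite !ltW.
  - apply: derivable_within_continuous => x; rewrite in_itv/= => xs.
    by have [] := dF x xs.
  rewrite in_itv/= subr0 !scale0r !addr0 => /andP[c0 cs].
  rewrite [z + s *: w' + s *: v']addrAC => ->.
  have [|r rs|d /andP[d0 ds]] := @mvt_line U ('D_v' F) (z + c *: v') w' s _ s0.
  - exact: smooth_on_derive.
  - by apply: Us => //; rewrite !ltW.
  rewrite [z + s *: w' + c *: v']addrAC => ->; exists c, d; split => //.
  - by rewrite !ltW.
  - by rewrite !ltW.
  - by rewrite mulrC.
have ctn v' w' : {for z, continuous ('D_v' ('D_w' F))}.
  by apply: smooth_on_continuous Uz; do 2 apply: smooth_on_derive.
apply/eqP; rewrite -subr_eq0 -normr_le0; apply/ler_addgt0Pl => e e0; rewrite addr0.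
have near_z v' w' : \forall y \near z, U y /\
    `|'D_v' ('D_w' F) z - 'D_v' ('D_w' F) y| < e / 2.
  apply: filterI; first exact: open_nbhs_nbhs.
  by have /cvgrPdist_lt/(_ (e / 2)) := ctn v' w'; apply; rewrite divr_gt0.
have [s1 s10 H1] := near_plane v w (near_z w v).
have [s2 s20 H2] := near_plane w v (near_z v w).
pose s := Num.min s1 s2.
have s0 : 0 < s by rewrite lt_min s10.
have le1 c : 0 <= c <= s -> 0 <= c <= s1.
  by move=> /andP[-> /le_trans->]//; rewrite ge_min lexx.
have le2 c : 0 <= c <= s -> 0 <= c <= s2.
  by move=> /andP[-> /le_trans->]//; rewrite ge_min lexx orbT.
have [c [d [cs ds E1]]] :=
  key v w s s0 (fun c d cs ds => (H1 c d (le1 c cs) (le1 d ds)).1).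
have [c' [d' [cs' ds' E2]]] :=
  key w v s s0 (fun c d cs ds => (H2 c d (le2 c cs) (le2 d ds)).1).
have eqm : 'D_w ('D_v F) (z + c *: v + d *: w) =
           'D_v ('D_w F) (z + c' *: w + d' *: v).
  apply: (mulfI (lt0r_neq0 s0)); apply: (mulfI (lt0r_neq0 s0)).
  apply: etrans (esym E1) _; apply: etrans _ E2; rewrite [z + s *: w + s *: v]addrAC.
  have swap (a b c0 d0 : R) : a - b - (c0 - d0) = a - c0 - (b - d0) by ring.
  exact: swap.
have [_ A1] := H1 c d (le1 _ cs) (le1 _ ds).
have [_ A2] := H2 c' d' (le2 _ cs') (le2 _ ds').
rewrite eqm in A1.
have tri (a b m : R) : `|a - m| < e / 2 -> `|b - m| < e / 2 -> `|a - b| <= e.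
  move=> am bm; rewrite -(subrKA m) [leRHS]splitr; apply: le_trans (ler_normD _ _) _.
  by apply: ltW; apply: ltrD; [exact: am|rewrite distrC; exact: bm].
exact: tri A2 A1.
Qed.

(** Second derivative test: a positive second derivative makes the first
    derivative positive just after the critical point, so the function
    increases there. *)
Lemma derive_at_max U F z v : open U -> smooth_on U F -> U z ->
  (forall y, U y -> F y <= F z) -> 'D_v F z = 0 /\ 'D_v ('D_v F) z <= 0.
Proof.
move=> oU sF Uz Fz.
have [s s0 Us] := near_plane v (- v) (open_nbhs_nbhs (conj oU Uz)).
have pos_near (G : E -> R) w : smooth_on U G -> 0 < G z ->
    (forall r, 0 <= r <= s -> U (z + r *: w)) ->
    exists2 r, 0 < r <= s & forall c, 0 <= c <= r -> 0 < G (z + c *: w).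
  move=> sG G0 Usw.
  have ct := smooth_on_continuous sG Uz.
  have /(near_plane w w)[e e0 He] := ct _ (open_nbhs_nbhs (conj (@open_gt R 0) G0)).
  exists (Num.min e s); first by rewrite lt_min e0 s0 ge_min lexx orbT.
  move=> c /andP[c0 ce]; have := He c 0; rewrite scale0r addr0; apply.
    by rewrite c0 (le_trans ce)// ge_min lexx.
  by rewrite lexx ltW.
have oneside w : (forall r, 0 <= r <= s -> U (z + r *: w)) -> 'D_w F z <= 0.
  move=> Usw; rewrite leNgt; apply/negP => D0.
  have [r /andP[r0 rs] Hr] := pos_near _ _ (smooth_on_derive w sF) D0 Usw.
  have Ur x : 0 <= x <= r -> U (z + x *: w).
    by move=> /andP[x0 xr]; apply: Usw; rewrite x0 (le_trans xr).
  have [c /andP[c0 cr] E1] := mvt_line sF r0 Ur.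
  have : 0 < F (z + r *: w) - F z by rewrite E1 mulr_gt0// Hr// !ltW.
  by rewrite ltNge subr_le0 Fz//; apply: Ur; rewrite lexx ltW.
have Usv r : 0 <= r <= s -> U (z + r *: v).
  by move=> rs; have := Us r 0 rs; rewrite scale0r addr0; apply; rewrite lexx ltW.
have D0 : 'D_v F z = 0.
  apply/eqP; rewrite eq_le oneside//= -oppr_le0.
  have dF := smooth_on_differentiable sF Uz.
  have -> : - 'D_v F z = 'D_(- v) F z by rewrite !deriveE// linearN.
  apply: oneside => r rs; have := Us 0 r; rewrite scale0r addr0; apply => //.
  by rewrite lexx ltW.
split=> //; rewrite leNgt; apply/negP => D2.
have [r /andP[r0 rs] Hr] := pos_near _ _ (smooth_on_derive v (smooth_on_derive v sF)) D2 Usv.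
have Ur t x : t <= r -> 0 <= x <= t -> U (z + x *: v).
  by move=> tr /andP[x0 xt]; apply: Usv; rewrite x0 (le_trans xt)// (le_trans tr).
have [c /andP[c0 cr] E1] := mvt_line sF r0 (fun x => @Ur r x (lexx r)).
have [d /andP[d0 dc]] := mvt_line (smooth_on_derive v sF) c0 (fun x => @Ur c x (ltW cr)).
rewrite D0 subr0 => E2.
have : 0 < F (z + r *: v) - F z.
  have dr : 0 <= d <= r by rewrite (ltW d0) (le_trans (ltW dc) (ltW cr)).
  rewrite E1 E2; exact: mulr_gt0 r0 (mulr_gt0 c0 (Hr d dr)).
by rewrite ltNge subr_le0 Fz//; apply: (Ur r) => //; rewrite lexx ltW.
Qed.

End Lines.

(** * Functions of time and space *)

Section WithinDerivative.
Variables (R : realType) (I : set R).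
Implicit Types (F G : R -> R) (s t l m : R).

Lemma is_derive_within_eq F G t l : I t -> (forall s, I s -> F s = G s) ->
  is_derive_within I F t l -> is_derive_within I G t l.
Proof.
move=> It FG; apply: cvg_trans; apply: near_eq_cvg; rewrite near_withinE.
by near=> s => Is; rewrite !FG.
Unshelve. all: by end_near. Qed.

Lemma is_derive_within_cst t (c : R) : is_derive_within I (fun=> c) t 0.
Proof.
rewrite /is_derive_within (_ : (fun s => _) = fun=> 0) ?subrr; first exact: cvg_cst.
by apply/funext => s; rewrite mul0r.
Qed.

Lemma is_derive_withinD F G t l m : is_derive_within I F t l ->
  is_derive_within I G t m -> is_derive_within I (fun s => F s + G s) t (l + m).
Proof.
move=> dF dG; apply: cvg_trans (cvgD dF dG); apply: near_eq_cvg.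
by near=> s; rewrite !fctE -mulrDl; congr (_ / _); ring.
Unshelve. all: by end_near. Qed.

Lemma is_derive_withinN F t l : is_derive_within I F t l ->
  is_derive_within I (fun s => - F s) t (- l).
Proof.
move=> dF; apply: cvg_trans (cvgN dF); apply: near_eq_cvg.
by near=> s; rewrite !fctE -mulNr; congr (_ / _); ring.
Unshelve. all: by end_near. Qed.

Lemma is_derive_within_id t : is_derive_within I id t 1.
Proof.
have : (fun=> 1 : R) s @[s --> within I t^'] --> (1 : R) by exact: cvg_cst.
apply: cvg_trans; apply: near_eq_cvg; rewrite !near_withinE; near=> s => st _.
by rewrite divff// subr_eq0.
Unshelve. all: by end_near. Qed.

Lemma is_derive_within_continuous F t l : is_derive_within I F t l ->
  F s @[s --> within I t^'] --> F t.
Proof.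
move=> dF.
have dst : s - t @[s --> within I t^'] --> 0.
  rewrite -(subrr t); apply: cvgB; last exact: cvg_cst.
  by do 2 apply: cvg_within_filter; exact: cvg_id.
have : (F s - F t) / (s - t) * (s - t) + F t @[s --> within I t^'] --> l * 0 + F t.
  by apply: cvgD; [exact: cvgM|exact: cvg_cst].
rewrite mulr0 add0r; apply: cvg_trans; apply: near_eq_cvg.
rewrite !near_withinE; near=> s => st _.
by rewrite divfK ?subrK// subr_eq0.
Unshelve. all: by end_near. Qed.

Lemma is_derive_withinM F G t l m : is_derive_within I F t l ->
  is_derive_within I G t m ->
  is_derive_within I (fun s => F s * G s) t (l * G t + F t * m).
Proof.
move=> dF dG; have cG := is_derive_within_continuous dG.
have : (F s - F t) / (s - t) * G s + F t * ((G s - G t) / (s - t))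
    @[s --> within I t^'] --> l * G t + F t * m.
  by apply: cvgD; apply: cvgM => //; exact: cvg_cst.
apply: cvg_trans; apply: near_eq_cvg; near=> s => /=.
by rewrite mulrAC mulrA -mulrDl; congr (_ / _); ring.
Unshelve. all: by end_near. Qed.

Lemma is_derive_within_sum (J : Type) (r : seq J) (P : pred J) (F : J -> R -> R)
    t (l : J -> R) :
  (forall j, P j -> is_derive_within I (F j) t (l j)) ->
  is_derive_within I (fun s => \sum_(j <- r | P j) F j s) t (\sum_(j <- r | P j) l j).
Proof.
move=> dF; elim: r => [|j r IH].
  rewrite big_nil (_ : (fun s => _) = fun=> 0); first exact: is_derive_within_cst.
  by apply/funext => s; rewrite big_nil.
rewrite big_cons (_ : (fun s => _) = fun s =>
  if P j then F j s + \sum_(j <- r | P j) F j s else \sum_(j <- r | P j) F j s).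
  by case: ifPn => // Pj; apply: is_derive_withinD => //; exact: dF.
by apply/funext => s; rewrite big_cons.
Qed.

Lemma is_derive_within_unique F t l m : ProperFilter (within I t^') ->
  is_derive_within I F t l -> is_derive_within I F t m -> l = m.
Proof. by move=> PF dl dm; exact: (cvg_unique _ dl dm). Qed.

End WithinDerivative.

Lemma within_itv_proper (R : realType) (T t : R) : 0 < T -> 0 <= t <= T ->
  ProperFilter (within `[0, T] t^').
Proof.
move=> T0 /andP[t0 tT].
apply: Build_ProperFilter_ex => P; move=> /=.
move=> /nbhs_ballP[e /= e0 eP].
have [tT'|tT'] := ltP t T.
  pose s := Num.min (t + e / 2) T.
  have ts : t < s by rewrite lt_min tT' andbT ltrDl divr_gt0.
  exists s; apply: eP => //=.
  - rewrite -ball_normE/= distrC gtr0_norm ?subr_gt0// ltrBlDl gt_min.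
    by rewrite ltrD2l ltr_pdivrMr// ltr_pMr// ltr1n.
  - by rewrite gt_eqF.
  - by rewrite in_itv/= (le_trans t0 (ltW ts)) ge_min lexx orbT.
pose s := Num.max (t - e / 2) 0.
have st : s < t.
  by rewrite gt_max (lt_le_trans T0 tT') andbT ltrBlDr ltrDl divr_gt0.
exists s; apply: eP => //=.
- rewrite -ball_normE/= gtr0_norm ?subr_gt0// ltrBlDr -ltrBlDl lt_max.
  by rewrite ltrD2l ltrN2 ltr_pdivrMr// ltr_pMr// ltr1n.
- by rewrite lt_eqF.
- by rewrite in_itv/= (le_trans (ltW st) tT) le_max lexx orbT.
Qed.

Section TimeSpace.
Variables (R : realType) (E : normedModType R).
Local Notation TE := (R^o * E)%type.
Implicit Types (U : set TE) (F : TE -> R) (W : set E) (I : set R).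

Lemma derive_slice F (t : R) v x :
  'D_v (fun y => F (t, y)) x = 'D_((0, v) : TE) F (t, x).
Proof.
rewrite /derive; set g1 := fun h => h^-1 *: _; set g2 := fun h => h^-1 *: _.
suff -> : g1 = g2 by [].
apply/funext => h; rewrite /g1 /g2 /=; congr (_ *: (F _ - _)).
by rewrite -[h *: (0, v)]/(h *: 0, h *: v) scaler0 -[(_, _) + _]/(_ + _, _ + _) add0r.
Qed.

Lemma open_slice U (t : R) : open U -> open [set x | U (t, x)].
Proof.
rewrite !openE => oU x /= /oU Ux.
have c : ((t, y) : TE) @[y --> x] --> ((t, x) : TE).
  apply: (@differentiable_continuous _ _ _ _ (fun y => (t, y) : TE)).
  by apply: differentiable_pair; [exact: differentiable_cst|exact: ex_diff].
exact: (c _ Ux).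
Qed.

Lemma near_time_slice U (t : R) x : open U -> U (t, x) ->
  \forall s \near t, U (s, x).
Proof.
rewrite openE => oU /oU Ux.
have c : ((s, x) : TE) @[s --> t] --> ((t, x) : TE).
  apply: (@differentiable_continuous _ _ _ _ (fun s => (s, x) : TE)).
  by apply: differentiable_pair; [exact: ex_diff|exact: differentiable_cst].
exact: (c _ Ux).
Qed.

Lemma differentiable_slice F (t : R) x : differentiable F (t, x) ->
  differentiable (fun y => F (t, y)) x.
Proof.
move=> dF; apply: (@differentiable_comp _ _ _ _ (fun y => (t, y) : TE)) => //.
Qed.

Lemma smooth_on_slice U F (t : R) : smooth_on U F ->
  smooth_on [set x | U (t, x)] (fun x => F (t, x)).
Proof.
move=> /smooth_onP sF; apply/smooth_onP => k; move/(_ k): sF.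
elim: k F => [|k IH] F /=; first by move=> dF x Ux; exact/differentiable_slice/dF.
move=> [dF DF]; split=> [x Ux|v]; first exact/differentiable_slice/dF.
rewrite (_ : 'D_v _ = fun x => 'D_((0, v) : TE) F (t, x)); first exact: (IH ('D_((0, v) : TE) F) (DF _)).
by apply/funext => x; exact: derive_slice.
Qed.

Lemma derive_time F (t : R) x I : differentiable F (t, x) ->
  is_derive_within I (fun s => F (s, x)) t ('D_((1, 0) : TE) F (t, x)).
Proof.
move=> dF.
have /cvg_ex[/= l dl] : derivable F (t, x) ((1, 0) : TE).
  exact: diff_derivable.
have -> : 'D_((1, 0) : TE) F (t, x) = l by exact: cvg_lim dl.
have shift0 : s - t @[s --> t^'] --> 0^'.
  move=> P /nbhs_ballP[e /= e0 eP]; apply/nbhs_ballP; exists e => //= s.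
  rewrite -ball_normE /= => ts st; apply: eP; last by rewrite subr_eq0.
  by rewrite -ball_normE /= sub0r opprB.
apply: cvg_within_filter; apply: cvg_trans (cvg_comp _ _ shift0 dl).
apply: near_eq_cvg; near=> s.
rewrite /= -[(s - t) *: (1, 0)]/((s - t) *: (1 : R^o), (s - t) *: 0) scaler0.
by rewrite -[(_, _) + _]/(_ + _, _ + _) add0r /= [_%:A]mulr1 subrK mulrC.
Unshelve. all: by end_near. Qed.

Definition space_time I W : set TE := [set z | I z.1 /\ W z.2].

Lemma smooth_within_slice I W F (t : R) : open W -> I t ->
  smooth_within (space_time I W) F -> smooth_on W (fun x => F (t, x)).
Proof.
move=> oW It sF; apply/smooth_within_open => // x Wx.
have [|U [G [oU Ux sG FG]]] := sF (t, x); first by split.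
exists [set y | U (t, y)], (fun y => G (t, y)); split=> //.
- exact: open_slice.
- exact: smooth_on_slice.
- by move=> y Wy Uy; apply: FG.
Qed.

Lemma space_derive_ext I W F U G (t : R) x v : open W -> I t -> W x ->
  open U -> U (t, x) ->
  (forall z, space_time I W z -> U z -> F z = G z) ->
  'D_v (fun y => F (t, y)) x = 'D_((0, v) : TE) G (t, x).
Proof.
move=> oW It Wx oU Ux FG; rewrite -derive_slice.
apply: (@derive_eq_on _ _ (W `&` [set y | U (t, y)])) => //.
  by apply: openI => //; exact: open_slice.
by move=> y [Wy Uy]; apply: FG.
Qed.

Lemma smooth_within_space_derive I W F v : open W ->
  smooth_within (space_time I W) F ->
  smooth_within (space_time I W) (fun z => 'D_v (fun y => F (z.1, y)) z.2).
Proof.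
move=> oW sF z Az; have [U [G [oU Uz sG FG]]] := sF z Az.
exists U, ('D_((0, v) : TE) G); split=> //; first exact: smooth_on_derive.
move=> [s y] [/= Is Wy] Uy; exact: (space_derive_ext v oW Is Wy oU Uy FG).
Qed.

Lemma smooth_within_time_derivable I W F (t : R) x : I t -> W x ->
  smooth_within (space_time I W) F ->
  exists l, is_derive_within I (fun s => F (s, x)) t l.
Proof.
move=> It Wx sF; have [|U [G [oU Ux sG FG]]] := sF (t, x); first by split.
exists ('D_((1, 0) : TE) G (t, x)).
have := derive_time I (smooth_on_differentiable sG Ux).
apply: cvg_trans; apply: near_eq_cvg; rewrite FG//.
have oUt := near_time_slice oU Ux.
rewrite !near_withinE; near=> s => _ Is; rewrite FG//; near: s; exact: oUt.
Unshelve. all: by end_near. Qed.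

(** Time and space derivatives commute up to the ends of the time interval:
    the smooth extension across the end has commuting derivatives, and its
    derivatives at the end are determined by the values on the interval. *)
Lemma time_space_derive_comm I W F (t : R) x v (a : E -> R) : open W -> I t -> W x ->
  ProperFilter (within I t^') ->
  smooth_within (space_time I W) F ->
  (forall y, W y -> is_derive_within I (fun s => F (s, y)) t (a y)) ->
  is_derive_within I (fun s => 'D_v (fun y => F (s, y)) x) t ('D_v a x).
Proof.
move=> oW It Wx PF sF dF; have [|U [G [oU Ux sG FG]]] := sF (t, x); first by split.
have oUt y := @near_time_slice U t y oU.
have Da y : W y -> U (t, y) -> 'D_((1, 0) : TE) G (t, y) = a y.
  move=> Wy Uy; apply: (is_derive_within_unique PF _ (dF y Wy)).
  have := derive_time I (smooth_on_differentiable sG Uy).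
  apply: cvg_trans; apply: near_eq_cvg; rewrite FG//.
  rewrite !near_withinE; near=> s => _ Is; rewrite FG//; near: s; exact: oUt.
have -> : 'D_v a x = 'D_((1, 0) : TE) ('D_((0, v) : TE) G) (t, x).
  rewrite (derive_comm _ _ oU sG Ux) -derive_slice.
  apply: (@derive_eq_on _ _ (W `&` [set y | U (t, y)])) => //.
    by apply: openI => //; exact: open_slice.
  by move=> y [Wy Uy]; rewrite Da.
have := derive_time I (smooth_on_differentiable (smooth_on_derive ((0, v) : TE) sG) Ux).
apply: cvg_trans; apply: near_eq_cvg.
rewrite (space_derive_ext v oW It Wx oU Ux FG).
rewrite !near_withinE; near=> s => _ Is.
rewrite (space_derive_ext v oW Is Wx oU _ FG)//; near: s; exact: oUt.
Unshelve. all: by end_near. Qed.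

End TimeSpace.

(** * Positive definite matrices *)

Section PosDef.
Variable R : realType.

Definition posdef n (S : 'M[R]_n) :=
  S^T = S /\ forall v : 'rV[R]_n, v != 0 -> 0 < (v *m S *m v^T) 0 0.

Definition psd n (B : 'M[R]_n) := forall v : 'rV[R]_n, 0 <= (v *m B *m v^T) 0 0.

Lemma posdef_psd n (S : 'M[R]_n) : posdef S -> psd S.
Proof.
move=> [_ S0] v; have [->|/S0/ltW//] := eqVneq v 0.
by rewrite !mul0mx mxE.
Qed.

Lemma posdef_unitmx n (S : 'M[R]_n) : posdef S -> S \in unitmx.
Proof.
move=> [_ S0]; rewrite -row_free_unit -kermx_eq0; apply/eqP/row_matrixP => i.
rewrite row0; apply/eqP; rewrite -[_ == 0]negbK; apply/negP => /S0.
have -> : row i (kermx S) *m S = 0 by rewrite -row_mul mulmx_ker row0.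
by rewrite mul0mx mxE ltxx.
Qed.

Lemma posdef_invmx n (S : 'M[R]_n) : posdef S -> posdef (invmx S).
Proof.
move=> pS; have uS := posdef_unitmx pS; have [sS S0] := pS.
have sI : (invmx S)^T = invmx S by rewrite trmx_inv sS.
split=> // v v0.
have -> : v *m invmx S *m v^T = (v *m invmx S) *m S *m (v *m invmx S)^T.
  by rewrite mulmxKV// trmx_mul sI mulmxA.
apply: S0; apply: contraNneq v0 => vS0.
by rewrite -(mulmxKV uS v) vS0 mul0mx.
Qed.

Lemma mx11E (A : 'M[R]_1) : A = (A 0 0)%:M.
Proof. by apply/matrixP => i j; rewrite !ord1 mxE eqxx mulr1n. Qed.

(** Splitting off the first pivot writes S as a rank-one square plus the Schur
    complement, which is again positive definite and one size smaller. *)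
Lemma trace_mul_ge0 n (S B : 'M[R]_n) : posdef S -> psd B -> 0 <= \tr (S *m B).
Proof.
elim: n S B => [|n IH] S B; first by rewrite /mxtrace big_ord0.
rewrite -[n.+1]/(1 + n)%N in S B * => -[sS S0] B0.
pose a := S 0 0; pose b := ursubmx S; pose D := drsubmx S.
have ulE : ulsubmx S = a%:M.
  by rewrite [LHS]mx11E; congr (_%:M); rewrite !mxE; congr (S _ _); apply/val_inj.
have dlE : dlsubmx S = b^T by rewrite /b trmx_ursub sS.
have sD : D^T = D by rewrite /D trmx_drsub sS.
have SE : S = block_mx a%:M b b^T D by rewrite -[LHS]submxK ulE dlE.
have quad (x : 'M[R]_1) (w : 'rV_n) : row_mx x w *m S *m (row_mx x w)^T =
    x *m a%:M *m x^T + w *m b^T *m x^T + (x *m b *m w^T + w *m D *m w^T).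
  by rewrite SE mul_row_block tr_row_mx mul_row_col !mulmxDl.
have a0 : 0 < a.
  have /S0 : row_mx (1%:M : 'M[R]_1) (0 : 'rV_n) != 0.
    apply/eqP => /(congr1 (fun M : 'rV_(1 + n) => lsubmx M)).
    rewrite row_mxKl linear0 => /matrixP/(_ 0 0); rewrite !mxE eqxx => /eqP.
    by rewrite oner_eq0.
  by rewrite quad !mul0mx !trmx1 !mul1mx trmx0 !mulmx0 !addr0 mulmx1 mxE eqxx mulr1n.
(* The Schur complement of the pivot a. *)
pose D' := D - a^-1 *: (b^T *m b).
have pD : posdef D'.
  split; first by rewrite /D' linearB linearZ/= trmx_mul trmxK sD.
  (* This first entry minimizes the form S over the vectors extending w. *)
  move=> w w0; pose x : 'M[R]_1 := - a^-1 *: (w *m b^T).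
  have /S0 : row_mx x w != 0.
    apply: contraNneq w0 => /(congr1 (fun M : 'rV_(1 + n) => rsubmx M)).
    by rewrite row_mxKr linear0 => ->.
  congr (0 < _); rewrite quad; congr (fun_of_matrix _ 0 0).
  have xT : x^T = - a^-1 *: (b *m w^T) by rewrite linearZ/= trmx_mul trmxK.
  have ax : x *m a%:M = - (w *m b^T).
    by rewrite mul_mx_scalar /x scalerA mulrN divff ?gt_eqF// scaleN1r.
  rewrite ax mulNmx addNr add0r /D' mulmxBr mulmxBl addrC; congr (_ + _).
  by rewrite /x -scalemxAr -!scalemxAl -!mulmxA scaleNr.
pose r := row_mx a%:M b : 'rV_(1 + n).
have SE' : S = a^-1 *: (r^T *m r) + block_mx 0 0 0 D'.
  rewrite SE /r tr_row_mx mul_col_row scale_block_mx add_block_mx !addr0.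
  rewrite !tr_scalar_mx mul_scalar_mx mul_mx_scalar mul_scalar_mx !scalerA mulVf ?gt_eqF//.
  by rewrite !scale1r [in RHS]/D' addrC subrK.
rewrite SE' mulmxDl linearD/= addr_ge0//.
  rewrite -scalemxAl linearZ/=; apply: mulr_ge0; first by rewrite invr_ge0 ltW.
  rewrite -mulmxA mxtrace_mulC trace_mx11; exact: (B0 r).
rewrite -[B]submxK mulmx_block mxtrace_block !mul0mx !addr0 add0r linear0 add0r.
apply: IH pD _ => w.
have := B0 (row_mx 0 w); congr (0 <= _).
rewrite -[B in LHS]submxK mul_row_block tr_row_mx trmx0 mul_row_col mulmx0 add0r.
by rewrite mul0mx add0r.
Qed.

Lemma trace_mulE n (S B : 'M[R]_n) : \tr (S *m B) = \sum_i \sum_j S i j * B j i.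
Proof. by apply: eq_bigr => i _; rewrite mxE. Qed.

End PosDef.

(** * Matrix-valued functions of the coordinates *)

Section MatrixCalculus.
Variables (R : realType) (n : nat) (V : set 'rV[R]_n).
Hypothesis oV : open V.
Local Notation X := 'rV[R]_n.
Implicit Types (x : X) (i j k l : 'I_n) (p q r : nat).

Definition smooth_mx p q (A : X -> 'M[R]_(p, q)) :=
  forall a b, smooth_on V (fun x => A x a b).

Definition partial_mx p q i (A : X -> 'M[R]_(p, q)) x : 'M[R]_(p, q) :=
  \matrix_(a, b) partial i (fun y => A y a b) x.

Lemma smooth_partial i (F : X -> R) : smooth_on V F -> smooth_on V (partial i F).
Proof. exact: smooth_on_derive. Qed.

Lemma partial_eq i (F F' : X -> R) x : (forall y, V y -> F y = F' y) -> V x ->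
  partial i F x = partial i F' x.
Proof. exact: derive_eq_on. Qed.

Lemma partialD i (F F' : X -> R) x : smooth_on V F -> smooth_on V F' -> V x ->
  partial i (fun y => F y + F' y) x = partial i F x + partial i F' x.
Proof. by move=> sF sF' Vx; apply: deriveD; apply: smooth_on_derivable Vx. Qed.

Lemma partialN i (F : X -> R) x : smooth_on V F -> V x ->
  partial i (fun y => - F y) x = - partial i F x.
Proof. by move=> sF Vx; apply: deriveN; apply: smooth_on_derivable Vx. Qed.

Lemma partialM i (F F' : X -> R) x : smooth_on V F -> smooth_on V F' -> V x ->
  partial i (fun y => F y * F' y) x = partial i F x * F' x + F x * partial i F' x.
Proof.
move=> sF sF' Vx; rewrite [RHS]addrC (mulrC (partial i F x)).
by apply: deriveM; apply: smooth_on_derivable Vx.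
Qed.

Lemma partial_cst i (c : R) x : partial i (fun=> c) x = 0.
Proof. exact: derive_cst. Qed.

Lemma partial_sum i (J : Type) (s : seq J) (Q : pred J) (F : J -> X -> R) x :
  (forall a, Q a -> smooth_on V (F a)) -> V x ->
  partial i (fun y => \sum_(a <- s | Q a) F a y) x =
  \sum_(a <- s | Q a) partial i (F a) x.
Proof.
move=> sF Vx; elim: s => [|a s IH].
  rewrite big_nil -[RHS](partial_cst i 0 x).
  by apply: partial_eq => // y _; rewrite big_nil.
rewrite big_cons -IH; have [Qa|Qa] := boolP (Q a); last first.
  by apply: partial_eq => // y _; rewrite big_cons (negbTE Qa).
rewrite -partialD//; [|exact: sF|exact: smooth_on_sum].
by apply: partial_eq => // y _; rewrite big_cons Qa.
Qed.

Lemma partial_comm i j (F : X -> R) x : smooth_on V F -> V x ->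
  partial i (partial j F) x = partial j (partial i F) x.
Proof. by move=> sF Vx; exact: (derive_comm _ _ oV sF Vx). Qed.

Lemma smooth_mx_add p q (A B : X -> 'M[R]_(p, q)) : smooth_mx A -> smooth_mx B ->
  smooth_mx (fun x => A x + B x).
Proof.
move=> sA sB a b; apply: smooth_on_eq (smooth_onD oV (sA a b) (sB a b)) => // y _.
by rewrite mxE.
Qed.

Lemma smooth_mx_opp p q (A : X -> 'M[R]_(p, q)) : smooth_mx A ->
  smooth_mx (fun x => - A x).
Proof.
move=> sA a b; apply: smooth_on_eq (smooth_onN oV (sA a b)) => // y _.
by rewrite mxE.
Qed.

Lemma smooth_mx_tr p q (A : X -> 'M[R]_(p, q)) : smooth_mx A ->
  smooth_mx (fun x => (A x)^T).
Proof.
by move=> sA a b; apply: smooth_on_eq (sA b a) => // y _; rewrite mxE.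
Qed.

Lemma smooth_mx_mul p q r (A : X -> 'M[R]_(p, q)) (B : X -> 'M[R]_(q, r)) :
  smooth_mx A -> smooth_mx B -> smooth_mx (fun x => A x *m B x).
Proof.
move=> sA sB a b.
apply: (@smooth_on_eq _ _ V (fun x => \sum_c A x a c * B x c b)) => //.
  by move=> y _; rewrite mxE.
by apply: smooth_on_sum => // c _; apply: smooth_onM.
Qed.

Lemma smooth_mx_partial p q i (A : X -> 'M[R]_(p, q)) : smooth_mx A ->
  smooth_mx (partial_mx i A).
Proof.
move=> sA a b; apply: smooth_on_eq (smooth_partial i (sA a b)) => // y _.
by rewrite mxE.
Qed.

Lemma partial_mx_eq p q i (A B : X -> 'M[R]_(p, q)) x :
  (forall y, V y -> A y = B y) -> V x -> partial_mx i A x = partial_mx i B x.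
Proof.
move=> AB Vx; apply/matrixP => a b; rewrite !mxE.
by apply: partial_eq => // y Vy; rewrite AB.
Qed.

Lemma partial_mx_add p q i (A B : X -> 'M[R]_(p, q)) x : smooth_mx A -> smooth_mx B ->
  V x -> partial_mx i (fun y => A y + B y) x = partial_mx i A x + partial_mx i B x.
Proof.
move=> sA sB Vx; apply/matrixP => a b; rewrite !mxE -partialD//.
by apply: partial_eq => // y _; rewrite mxE.
Qed.

Lemma partial_mx_opp p q i (A : X -> 'M[R]_(p, q)) x : smooth_mx A ->
  V x -> partial_mx i (fun y => - A y) x = - partial_mx i A x.
Proof.
move=> sA Vx; apply/matrixP => a b; rewrite !mxE -partialN//.
by apply: partial_eq => // y _; rewrite mxE.
Qed.

Lemma partial_mx_tr p q i (A : X -> 'M[R]_(p, q)) x : V x ->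
  partial_mx i (fun y => (A y)^T) x = (partial_mx i A x)^T.
Proof.
move=> Vx; apply/matrixP => a b; rewrite !mxE.
by apply: partial_eq => // y _; rewrite mxE.
Qed.

Lemma partial_mx_mul p q r i (A : X -> 'M[R]_(p, q)) (B : X -> 'M[R]_(q, r)) x :
  smooth_mx A -> smooth_mx B -> V x ->
  partial_mx i (fun y => A y *m B y) x =
  partial_mx i A x *m B x + A x *m partial_mx i B x.
Proof.
move=> sA sB Vx; apply/matrixP => a b; rewrite !mxE -big_split/=.
rewrite (@partial_eq i _ (fun y => \sum_c A y a c * B y c b))//; last first.
  by move=> y _; rewrite mxE.
rewrite partial_sum//; last by move=> c _; exact: smooth_onM.
by apply: eq_bigr => c _; rewrite partialM// !mxE.
Qed.

Lemma partial_mx_comm p q i j (A : X -> 'M[R]_(p, q)) x : smooth_mx A -> V x ->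
  partial_mx i (partial_mx j A) x = partial_mx j (partial_mx i A) x.
Proof.
move=> sA Vx; apply/matrixP => a b.
rewrite [LHS]mxE. rewrite [RHS]mxE.
have entry k : forall y, V y -> partial_mx k A y a b = partial k (fun z => A z a b) y.
  by move=> y _; rewrite mxE.
apply: etrans (partial_eq i (entry j) Vx) _.
apply: etrans (partial_comm i j (sA a b) Vx) _.
exact: esym (partial_eq j (entry i) Vx).
Qed.

Lemma partial_trace p i (A : X -> 'M[R]_p) x : smooth_mx A -> V x ->
  partial i (fun y => \tr (A y)) x = \tr (partial_mx i A x).
Proof.
by move=> sA Vx; rewrite partial_sum//; apply: eq_bigr => a _; rewrite mxE.
Qed.

End MatrixCalculus.

(** * Local Riemannian geometry and the Bochner formula *)

Section Bochner.
Variables (R : realType) (n : nat) (V : set 'rV[R]_n).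
Hypothesis oV : open V.
Local Notation X := 'rV[R]_n.
Implicit Types (x y : X) (i j k l : 'I_n).

Variable G : X -> 'M[R]_n.
Hypothesis sG : smooth_mx V G.
Hypothesis symG : forall x, V x -> (G x)^T = G x.
Hypothesis unitG : forall x, V x -> G x \in unitmx.

Definition inv_metric x := invmx (G x).

(** The connection matrices: (Gamma i)_(j, k) is the d_k-component of the
    covariant derivative of d_j along d_i. *)
Definition Gamma i x : 'M[R]_n := \matrix_(j, k) christoffel G k i j x.

(** The endomorphism R(d_i, d_j), acting on row vectors of components. *)
Definition curv i j x : 'M[R]_n := \matrix_(k, l) riemann G i j k l x.

Lemma smooth_inv_metric : smooth_mx V inv_metric.
Proof. by move=> a b; apply: smooth_on_invmx. Qed.

Lemma sym_inv_metric x : V x -> (inv_metric x)^T = inv_metric x.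
Proof. by move=> Vx; rewrite trmx_inv symG. Qed.

Lemma partial_metric_sym x i j k : V x ->
  partial i (fun y => G y j k) x = partial i (fun y => G y k j) x.
Proof.
move=> Vx; apply: partial_eq Vx => // y Vy; rewrite -[in LHS](symG Vy).
by rewrite mxE.
Qed.

Lemma christoffel_sym x k i j : V x -> christoffel G k i j x = christoffel G k j i x.
Proof.
move=> Vx; congr (_ * _); apply: eq_bigr => l _; congr (_ * _).
by rewrite (partial_metric_sym l i j Vx) [X in X - _ = _]addrC.
Qed.

Lemma smooth_Gamma i : smooth_mx V (Gamma i).
Proof.
move=> j k; apply: (@smooth_on_eq _ _ V (christoffel G k i j)) => //.
  by move=> y _; rewrite mxE.
apply: smooth_onM => //; first exact: smooth_on_cst.
apply: smooth_on_sum => // l _; apply: smooth_onM => //; first exact: smooth_inv_metric.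
have sp a b c : smooth_on V (partial a (fun y => G y b c)) by exact: smooth_partial.
by apply: smooth_onD => //; [exact: smooth_onD|exact: smooth_onN].
Qed.

Lemma Gamma_mul_metric x i j k : V x -> (Gamma i x *m G x) j k =
  2^-1 * (partial i (fun y => G y j k) x + partial j (fun y => G y i k) x
          - partial k (fun y => G y i j) x).
Proof.
move=> Vx.
pose K := \matrix_(j, l) (partial i (fun y => G y j l) x
  + partial j (fun y => G y i l) x - partial l (fun y => G y i j) x) : 'M[R]_n.
have -> : Gamma i x = 2^-1 *: (K *m inv_metric x).
  apply/matrixP => a b; rewrite [LHS]mxE [RHS]mxE [X in _ * X]mxE; congr (_ * _).
  apply: eq_bigr => l _; rewrite [K _ _]mxE mulrC; congr (_ * _).
  by rewrite -[in RHS](sym_inv_metric Vx) mxE.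
by rewrite -scalemxAl mulmxKV ?unitG// [LHS]mxE [K _ _]mxE.
Qed.

Lemma partial_metric x i : V x ->
  partial_mx i G x = Gamma i x *m G x + G x *m (Gamma i x)^T.
Proof.
move=> Vx; have -> : G x *m (Gamma i x)^T = (Gamma i x *m G x)^T.
  by rewrite trmx_mul symG.
apply/matrixP => j k; rewrite [RHS]mxE [X in _ + X]mxE !Gamma_mul_metric//.
rewrite [LHS]mxE (partial_metric_sym i k j Vx).
by field.
Qed.

(** Obtained by differentiating the product of the metric with its inverse. *)
Lemma partial_inv_metric x i : V x -> partial_mx i inv_metric x =
  - (inv_metric x *m Gamma i x + (Gamma i x)^T *m inv_metric x).
Proof.
move=> Vx; have uG := unitG Vx.
have : partial_mx i (fun y => inv_metric y *m G y) x = 0.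
  apply/matrixP => a b; rewrite [LHS]mxE [RHS]mxE -[RHS](partial_cst i ((1%:M : 'M[R]_n) a b) x).
  by apply: partial_eq Vx => // y Vy; rewrite mulVmx// unitG.
rewrite (partial_mx_mul oV i smooth_inv_metric sG Vx) partial_metric// mulmxDr !mulmxA.
rewrite -[inv_metric x *m G x]/(invmx (G x) *m G x) mulVmx// mul1mx => /eqP.
rewrite addrC addr_eq0 => /eqP/(congr1 (mulmx^~ (inv_metric x))).
rewrite mulmxDl mulNmx !mulmxK// => E.
by rewrite E opprK.
Qed.

Lemma curvE x i j : V x -> curv i j x =
  partial_mx i (Gamma j) x - partial_mx j (Gamma i) x
  + (Gamma j x *m Gamma i x - Gamma i x *m Gamma j x).
Proof.
move=> Vx; apply/matrixP => k l.
rewrite [LHS]mxE [RHS]mxE [X in _ = X + _]mxE [X in _ = _ + X]mxE.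
rewrite [X in _ = _ + X + _]mxE [X in _ = _ + (_ + X)]mxE.
have e a b : partial a (christoffel G l b k) x = (partial_mx a (Gamma b) x) k l.
  rewrite [RHS]mxE; apply: partial_eq Vx => // y _.
  by rewrite mxE.
rewrite /riemann !e; congr (_ + _).
rewrite [X in _ = X + _]mxE [X in _ = _ - X]mxE -sumrB; apply: eq_bigr => m _.
have eG a b c : Gamma a x b c = christoffel G c a b x by rewrite mxE.
by rewrite !eG [X in X - _]mulrC [X in _ - X]mulrC.
Qed.

(** Skew-symmetry of the curvature in its last two indices, because second
    derivatives of the metric commute. *)
Lemma curv_skew x i j : V x -> curv i j x *m G x + G x *m (curv i j x)^T = 0.
Proof.
move=> Vx.
have sGa a : smooth_mx V (Gamma a) by exact: smooth_Gamma.
have dd a b : partial_mx a (partial_mx b G) x =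
    partial_mx a (Gamma b) x *m G x
    + Gamma b x *m (Gamma a x *m G x + G x *m (Gamma a x)^T)
    + ((Gamma a x *m G x + G x *m (Gamma a x)^T) *m (Gamma b x)^T
       + G x *m (partial_mx a (Gamma b) x)^T).
  rewrite -!partial_metric// -(partial_mx_tr oV a (Gamma b) Vx).
  have sT : smooth_mx V (fun y => (Gamma b y)^T) by exact: smooth_mx_tr.
  rewrite -(partial_mx_mul oV a sG sT Vx) -(partial_mx_mul oV a (sGa b) sG Vx).
  rewrite -(partial_mx_add oV a (smooth_mx_mul oV (sGa b) sG) (smooth_mx_mul oV sG sT) Vx).
  by apply: partial_mx_eq Vx => // y Vy; rewrite partial_metric.
have := partial_mx_comm oV i j sG Vx; rewrite !dd (curvE i j Vx).
move: (Gamma i x) (Gamma j x) (partial_mx i (Gamma j) x) (partial_mx j (Gamma i) x) (G x).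
move=> Ci Cj Dij Dji g.
have trD (A B : 'M[R]_n) : (A + B)^T = A^T + B^T by exact: linearD.
have trN (A : 'M[R]_n) : (- A)^T = - A^T by exact: linearN.
rewrite !(trD, trN) !trmx_mul.
rewrite !(mulmxDr, mulmxDl, mulNmx, mulmxN).
rewrite !mulmxA.
move: (Dij *m g) (Dji *m g) (Cj *m Ci *m g) (Ci *m Cj *m g) (Cj *m g *m Ci^T).
move: (Ci *m g *m Cj^T) (g *m Ci^T *m Cj^T) (g *m Cj^T *m Ci^T) (g *m Dij^T) (g *m Dji^T).
move=> a1 a2 a3 a4 a5 a6 a7 a8 a9 a10 /matrixP H.
apply/matrixP => a b; have := H a b; rewrite !mxE; lra.
Qed.

Lemma inv_metric_curv x i j : V x ->
  inv_metric x *m curv i j x = - ((curv i j x)^T *m inv_metric x).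
Proof.
move=> Vx; have uG := unitG Vx; have /eqP := curv_skew i j Vx.
rewrite addr_eq0 => /eqP E; rewrite -[in LHS](mulmxK uG (curv i j x)) E.
by rewrite mulNmx mulmxN -/(inv_metric x) !mulmxA mulVmx// mul1mx.
Qed.

Variable u : X -> R.
Hypothesis su : smooth_on V u.

Definition du x : 'cV[R]_n := \col_i partial i u x.
Definition grad_col x : 'cV[R]_n := inv_metric x *m du x.
Definition hess x : 'M[R]_n := \matrix_(i, j) hessian G u i j x.
Definition sqnorm_grad x : R := normsq G x (gradient G u x).
(** Covariant derivative of the Hessian along d_i. *)
Definition cov_hess i x : 'M[R]_n :=
  partial_mx i hess x - Gamma i x *m hess x - hess x *m (Gamma i x)^T.

Lemma smooth_du : smooth_mx V du.
Proof.
move=> i j; apply: (@smooth_on_eq _ _ V (partial i u)) => //.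
  by move=> y _; rewrite mxE.
exact: smooth_partial.
Qed.

Lemma smooth_grad_col : smooth_mx V grad_col.
Proof. exact: smooth_mx_mul smooth_inv_metric smooth_du. Qed.

Lemma gradientE x i : gradient G u x 0 i = grad_col x i 0.
Proof. by rewrite !mxE; apply: eq_bigr => j _; rewrite mxE. Qed.

Lemma sqnorm_gradE x : V x -> sqnorm_grad x = ((du x)^T *m grad_col x) 0 0.
Proof.
move=> Vx; have -> : (du x)^T = (grad_col x)^T *m G x.
  by rewrite trmx_mul (sym_inv_metric Vx) -mulmxA mulVmx ?mulmx1// unitG.
rewrite [RHS]mxE /sqnorm_grad /normsq exchange_big/=; apply: eq_bigr => j _.
rewrite [X in _ = X * _]mxE mulr_suml; apply: eq_bigr => i _.
by rewrite !gradientE [X in _ = X * _ * _]mxE [X in X * _]mulrC.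
Qed.

Lemma hess_row i x : (row i (hess x))^T = partial_mx i du x - Gamma i x *m du x.
Proof.
apply/matrixP => j b; rewrite ord1 [LHS]mxE [LHS]mxE [LHS]mxE [RHS]mxE [X in _ + X]mxE.
congr (_ - _).
  rewrite [RHS]mxE; congr (partial i _ x); apply/funext => y; by rewrite mxE.
rewrite [RHS]mxE; apply: eq_bigr => k _.
by rewrite [Gamma i x j k]mxE [du x k 0]mxE.
Qed.

Lemma hess_sym x : V x -> (hess x)^T = hess x.
Proof.
move=> Vx; apply/matrixP => i j; rewrite [LHS]mxE [LHS]mxE [RHS]mxE.
rewrite /hessian (partial_comm oV j i su Vx).
by under eq_bigr => k _ do rewrite (christoffel_sym k j i Vx).
Qed.

Lemma smooth_hess_row i : smooth_mx V (fun x => (row i (hess x))^T).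
Proof.
have s1 : smooth_mx V (fun x => partial_mx i du x - Gamma i x *m du x).
  apply: smooth_mx_add => //; first exact: smooth_mx_partial smooth_du.
  by apply: smooth_mx_opp => //; exact: smooth_mx_mul (smooth_Gamma i) smooth_du.
move=> a b; apply: smooth_on_eq (s1 a b) => // y _.
by rewrite hess_row.
Qed.

Lemma smooth_hess : smooth_mx V hess.
Proof.
move=> i j; apply: smooth_on_eq (smooth_hess_row i j 0) => // y _.
by rewrite mxE mxE.
Qed.

Lemma partial_hess_row l i x :
  partial_mx l (fun y => (row i (hess y))^T) x = (row i (partial_mx l hess x))^T.
Proof.
apply/matrixP => a b; rewrite [LHS]mxE [RHS]mxE [RHS]mxE [RHS]mxE.
by congr (partial l _ x); apply/funext => y; rewrite mxE mxE.
Qed.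

Lemma cov_hess_sym i x : V x -> (cov_hess i x)^T = cov_hess i x.
Proof.
move=> Vx.
have trD (A B : 'M[R]_n) : (A + B)^T = A^T + B^T by exact: linearD.
have trN (A : 'M[R]_n) : (- A)^T = - A^T by exact: linearN.
have dT : (partial_mx i hess x)^T = partial_mx i hess x.
  rewrite -(partial_mx_tr oV i hess Vx).
  exact: (partial_mx_eq oV i (fun y => @hess_sym y) Vx).
by rewrite /cov_hess !(trD, trN) dT !trmx_mul trmxK (hess_sym Vx) addrAC.
Qed.

(** The Ricci identity: the third derivatives of u cancel, and what remains of the
    commutator is the curvature of the connection applied to du. *)
Lemma cov_hess_comm l i x : V x ->
  (row i (cov_hess l x))^T = (row l (cov_hess i x))^T - curv l i x *m du x.
Proof.
move=> Vx.
have sGa a : smooth_mx V (Gamma a) by exact: smooth_Gamma.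
have sd := smooth_du.
have lin b (A B C : 'M[R]_n) :
    (row b (A - B - C))^T = (row b A)^T - (row b B)^T - (row b C)^T.
  by apply/matrixP => c d; rewrite !mxE.
have swap : row i (Gamma l x *m hess x) = row l (Gamma i x *m hess x).
  apply/matrixP => a b; rewrite [LHS]mxE [RHS]mxE [LHS]mxE [RHS]mxE.
  apply: eq_bigr => m _; congr (_ * _).
  by rewrite [LHS]mxE [RHS]mxE christoffel_sym.
have dr a b : (row b (partial_mx a hess x))^T =
    partial_mx a (partial_mx b du) x
    - (partial_mx a (Gamma b) x *m du x + Gamma b x *m partial_mx a du x).
  rewrite -partial_hess_row -(partial_mx_mul oV a (sGa b) sd Vx).
  rewrite -(partial_mx_opp oV a (smooth_mx_mul oV (sGa b) sd) Vx).
  rewrite -(partial_mx_add oV a (smooth_mx_partial oV b sd)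
    (smooth_mx_opp oV (smooth_mx_mul oV (sGa b) sd)) Vx).
  by apply: (partial_mx_eq oV a) Vx => y _; rewrite hess_row.
have rr a b : (row b (hess x *m (Gamma a x)^T))^T =
    Gamma a x *m (partial_mx b du x - Gamma b x *m du x).
  by rewrite row_mul trmx_mul trmxK hess_row.
have sub_eq p q (A A' B C C' : 'M[R]_(p, q)) :
  A = A' -> C = C' -> A - B - C = A' - B - C' by move=> -> ->.
have e a b := etrans (lin b (partial_mx a hess x) (Gamma a x *m hess x)
    (hess x *m (Gamma a x)^T)) (sub_eq _ _ _ _ _ _ _ (dr a b) (rr a b)).
have alg (A A' B B' Z : 'cV[R]_n) (w w' : 'rV[R]_n) : w = w' ->
    A - B = A' - B' - Z -> A - w^T - B = A' - w'^T - B' - Z.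
  by move=> -> AB; rewrite addrAC AB; apply/matrixP => a b; rewrite !mxE; ring.
apply: etrans (e l i) _.
apply: etrans _ (congr1 (fun z => z - curv l i x *m du x) (esym (e i l))).
apply: (alg _ _ _ _ _ _ _ swap).
rewrite (curvE l i Vx).
rewrite (partial_mx_comm oV l i sd Vx).
move: (partial_mx i (partial_mx l du) x).
move: (partial_mx l (Gamma i) x) (partial_mx i (Gamma l) x).
move: (partial_mx l du x) (partial_mx i du x) (Gamma l x) (Gamma i x) (du x).
move=> hl hi Cl Ci h Dli Dil hil.
rewrite !(mulmxDr, mulmxDl, mulNmx, mulmxN) !mulmxA.
move: (Ci *m hl) (Cl *m hi) (Cl *m Ci *m h) (Ci *m Cl *m h) (Dil *m h) (Dli *m h).
move=> a1 a2 a3 a4 a5 a6.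
apply/matrixP => a b; rewrite !mxE; ring.
Qed.

Lemma partial_du l x : partial_mx l du x = (row l (hess x))^T + Gamma l x *m du x.
Proof. by rewrite hess_row subrK. Qed.

Lemma partial_grad_col l x : V x -> partial_mx l grad_col x =
  inv_metric x *m (row l (hess x))^T - (Gamma l x)^T *m grad_col x.
Proof.
move=> Vx; rewrite (partial_mx_mul oV l smooth_inv_metric smooth_du Vx).
rewrite (partial_inv_metric l Vx) partial_du /grad_col.
move: (inv_metric x) (Gamma l x) (du x) (row l (hess x))^T => N C h s.
rewrite !(mulmxDr, mulmxDl, mulNmx, mulmxN) !mulmxA.
move: (N *m C *m h) (C^T *m N *m h) (N *m s) => a1 a2 a3.
by apply/matrixP => a b; rewrite !mxE; ring.
Qed.

(** Since the metric is parallel only the two factors du are differentiated, and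
    they contribute equally. *)
Lemma partial_sqnorm_grad k x : V x ->
  partial k sqnorm_grad x = 2 * (hess x *m grad_col x) k 0.
Proof.
move=> Vx; have sN := sym_inv_metric Vx.
have -> : partial k sqnorm_grad x =
    partial_mx k (fun y => (du y)^T *m grad_col y) x 0 0.
  by rewrite [RHS]mxE; apply: partial_eq Vx => // y Vy; rewrite sqnorm_gradE.
rewrite (partial_mx_mul oV k (smooth_mx_tr oV smooth_du) smooth_grad_col Vx).
rewrite (partial_mx_tr oV k du Vx) partial_du (partial_grad_col k Vx).
have trD p q (A B : 'M[R]_(p, q)) : (A + B)^T = A^T + B^T by exact: linearD.
rewrite trD trmx_mul trmxK mulmxDl mulmxBr !mulmxA.
have cancel (a b c : 'M[R]_1) : a + b + (c - b) = a + c.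
  by rewrite addrACA subrr addr0.
rewrite cancel.
have e : (row k (hess x) *m inv_metric x *m du x) 0 0 = (hess x *m grad_col x) k 0.
  by rewrite -mulmxA -row_mul mxE.
have -> : (du x)^T *m inv_metric x *m (row k (hess x))^T =
    (row k (hess x) *m inv_metric x *m du x)^T.
  by rewrite !trmx_mul sN mulmxA.
by rewrite mxE [X in _ + X]mxE e /grad_col mulmxA; ring.
Qed.

Lemma hess_sqnorm_grad l k x : V x -> hessian G sqnorm_grad l k x =
  2 * (cov_hess l x *m grad_col x + hess x *m inv_metric x *m (row l (hess x))^T) k 0.
Proof.
move=> Vx; rewrite /hessian.
have -> : partial l (partial k sqnorm_grad) x =
    2 * partial_mx l (fun y => hess y *m grad_col y) x k 0.
  rewrite (@partial_eq _ _ V oV l _ (fun y => 2 * (hess y *m grad_col y) k 0) x _ Vx).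
    rewrite (@partialM _ _ V l (fun=> 2) (fun y => (hess y *m grad_col y) k 0) x).
    - by rewrite partial_cst mul0r add0r; congr (_ * _); rewrite mxE.
    - exact: smooth_on_cst.
    - exact: (smooth_mx_mul oV smooth_hess smooth_grad_col).
    - exact: Vx.
  by move=> y Vy; exact: partial_sqnorm_grad.
have -> : \sum_k0 christoffel G k0 l k x * partial k0 sqnorm_grad x =
    2 * (Gamma l x *m (hess x *m grad_col x)) k 0.
  rewrite [X in _ = _ * X]mxE mulr_sumr; apply: eq_bigr => m _.
  rewrite (partial_sqnorm_grad m Vx) [Gamma l x k m]mxE mulrCA.
  by [].
rewrite -mulrBr; congr (_ * _).
rewrite (partial_mx_mul oV l smooth_hess smooth_grad_col Vx) (partial_grad_col l Vx).
rewrite /cov_hess.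
move: (inv_metric x) (Gamma l x) (grad_col x) (row l (hess x))^T (partial_mx l hess x).
move: (hess x) => S N C v s D.
rewrite !(mulmxDr, mulmxDl, mulNmx, mulmxN) !mulmxA.
move: (D *m v) (C *m S *m v) (S *m C^T *m v) (S *m N *m s) => a1 a2 a3 a4.
by rewrite !mxE; ring.
Qed.

Lemma laplacianE x : V x -> laplacian G u x = \tr (inv_metric x *m hess x).
Proof.
move=> Vx; rewrite trace_mulE; apply: eq_bigr => i _; apply: eq_bigr => j _.
by congr (_ * _); rewrite -[in RHS](hess_sym Vx) [RHS]mxE [RHS]mxE.
Qed.

(** The Laplacian is the trace of the Hessian and the metric is parallel, so its
    derivative is the trace of the covariant derivative of the Hessian. *)
Lemma partial_laplacian i x : V x ->
  partial i (laplacian G u) x = \tr (inv_metric x *m cov_hess i x).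
Proof.
move=> Vx.
have -> : partial i (laplacian G u) x = partial i (fun y => \tr (inv_metric y *m hess y)) x.
  by apply: partial_eq Vx => // y Vy; exact: laplacianE.
rewrite (partial_trace oV i (smooth_mx_mul oV smooth_inv_metric smooth_hess) Vx).
rewrite (partial_mx_mul oV i smooth_inv_metric smooth_hess Vx) (partial_inv_metric i Vx).
have trD (A B : 'M[R]_n) : \tr (A + B) = \tr A + \tr B by exact: linearD.
have trN (A : 'M[R]_n) : \tr (- A) = - \tr A by exact: linearN.
rewrite /cov_hess.
move: (inv_metric x) (Gamma i x) (hess x) (partial_mx i hess x) => N C S D.
rewrite !(mulmxDr, mulmxDl, mulNmx, mulmxN) !(trD, trN).
by rewrite -[C^T *m N *m S]mulmxA [\tr (C^T *m _)]mxtrace_mulC !mulmxA; ring.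
Qed.

(** Bochner: commuting the derivatives in the third-order term costs one
    curvature term, whose trace is the Ricci curvature. *)
Theorem bochner x : V x -> laplacian G sqnorm_grad x =
  2 * \tr (inv_metric x *m (hess x *m inv_metric x *m hess x))
  + 2 * \sum_i grad_col x i 0 * partial i (laplacian G u) x
  + 2 * \sum_i \sum_j ricci G i j x * grad_col x i 0 * grad_col x j 0.
Proof.
move=> Vx.
have sN := sym_inv_metric Vx.
(* The third-order term, with the derivative index moved by the Ricci identity. *)
have third l k : (cov_hess l x *m grad_col x) k 0 =
    \sum_i (cov_hess i x l k - (curv l i x *m du x) k 0) * grad_col x i 0.
  rewrite mxE; apply: eq_bigr => i _; congr (_ * _).
  have := congr1 (fun A : 'cV_n => A k 0) (cov_hess_comm l i Vx).
  rewrite [LHS]mxE [LHS]mxE [RHS]mxE [X in X + _]mxE [X in X + _]mxE [X in _ + X]mxE => <-.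
  by rewrite -[in LHS](cov_hess_sym l Vx) mxE.
(* The curvature terms trace to the Ricci curvature, by skew-symmetry. *)
have ric i : - \sum_l \sum_k inv_metric x l k * (curv l i x *m du x) k 0 =
    \sum_j ricci G i j x * grad_col x j 0.
  rewrite -sumrN.
  transitivity (\sum_l \sum_j riemann G l i j l x * grad_col x j 0).
    apply: eq_bigr => l _.
    have -> : \sum_k inv_metric x l k * (curv l i x *m du x) k 0 =
        (inv_metric x *m (curv l i x *m du x)) l 0 by rewrite mxE.
    rewrite mulmxA (inv_metric_curv l i Vx) mulNmx -mulmxA -/(grad_col x).
    rewrite [X in - X]mxE opprK mxE; apply: eq_bigr => j _; congr (_ * _).
    by rewrite mxE mxE.
  by rewrite exchange_big; apply: eq_bigr => j _; rewrite mulr_suml.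
transitivity (\sum_l \sum_k (2 * (inv_metric x l k *
     (hess x *m inv_metric x *m hess x) k l) +
   2 * (inv_metric x l k * (cov_hess l x *m grad_col x) k 0))).
  apply: eq_bigr => l _; apply: eq_bigr => k _; rewrite hess_sqnorm_grad//.
  have -> : (hess x *m inv_metric x *m hess x) k l =
     (hess x *m inv_metric x *m (row l (hess x))^T) k 0.
    rewrite [LHS]mxE [RHS]mxE; apply: eq_bigr => m _; congr (_ * _).
    by rewrite -[in LHS](hess_sym Vx) [LHS]mxE [RHS]mxE [RHS]mxE.
  by rewrite [X in _ * (2 * X) = _]mxE; ring.
under eq_bigr do rewrite big_split/= -!mulr_sumr.
rewrite big_split/= -!mulr_sumr -trace_mulE -addrA -[X in _ = _ + X]mulrDr; congr (_ + 2 * _).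
transitivity (\sum_l \sum_i \sum_k inv_metric x l k *
    ((cov_hess i x l k - (curv l i x *m du x) k 0) * grad_col x i 0)).
  apply: eq_bigr => l _; rewrite exchange_big/=; apply: eq_bigr => k _.
  by rewrite third mulr_sumr.
rewrite exchange_big/= -big_split/=; apply: eq_bigr => i _.
transitivity (grad_col x i 0 * (\sum_l \sum_k inv_metric x l k * cov_hess i x l k
   - \sum_l \sum_k inv_metric x l k * (curv l i x *m du x) k 0)).
  rewrite -sumrB mulr_sumr; apply: eq_bigr => l _.
  by rewrite -sumrB mulr_sumr; apply: eq_bigr => k _; ring.
rewrite mulrDr ric; congr (_ + _).
  congr (_ * _); rewrite (partial_laplacian i Vx) trace_mulE.
  apply: eq_bigr => l _; apply: eq_bigr => k _; congr (_ * _).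
  by rewrite -[in RHS](cov_hess_sym i Vx) [RHS]mxE.
by rewrite mulr_sumr; apply: eq_bigr => j _; ring.
Qed.

End Bochner.

(** * Nonnegative curvature operator implies nonnegative Ricci curvature *)

Section RicciSign.
Variables (R : realType) (n : nat) (V : set 'rV[R]_n).
Hypothesis oV : open V.
Variable G : 'rV[R]_n -> 'M[R]_n.
Hypothesis sG : smooth_mx V G.
Hypothesis symG : forall x, V x -> (G x)^T = G x.
Hypothesis unitG : forall x, V x -> G x \in unitmx.
Implicit Types (x : 'rV[R]_n) (i j k l : 'I_n).

Lemma riemann_low_antisym_l i j k l x : riemann_low G i j k l x = - riemann_low G j i k l x.
Proof.
rewrite -sumrN; apply: eq_bigr => m _; rewrite -mulrN; congr (_ * _).
rewrite /riemann opprD opprB -sumrN; congr (_ + _).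
by apply: eq_bigr => p _; rewrite opprB.
Qed.

Lemma riemann_low_antisym_r i j k l x : V x ->
  riemann_low G i j k l x = - riemann_low G i j l k x.
Proof.
move=> Vx; apply/eqP; rewrite -addr_eq0; apply/eqP.
have /matrixP/(_ k l) := curv_skew oV sG symG unitG i j Vx.
rewrite [LHS]mxE [RHS]mxE [X in X + _]mxE [X in _ + X]mxE => E.
apply: etrans _ E; congr (_ + _); apply: eq_bigr => m _.
  by rewrite mulrC -[in LHS](symG Vx) [X in _ * X]mxE [X in _ = X * _]mxE.
by rewrite [X in _ = _ * X]mxE [X in _ = _ * X]mxE.
Qed.

Lemma antisym_sum (e v : 'I_n -> R) (F : 'I_n -> 'I_n -> R) :
  (forall i j, F i j = - F j i) ->
  \sum_i \sum_j (e i * v j - e j * v i) * F i j = 2 * \sum_i \sum_j e i * v j * F i j.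
Proof.
move=> aF.
rewrite (_ : \sum_i \sum_j (e i * v j - e j * v i) * F i j =
  \sum_i \sum_j e i * v j * F i j + \sum_i \sum_j e j * v i * F j i); last first.
  rewrite -big_split; apply: eq_bigr => i _; rewrite -big_split; apply: eq_bigr => j _.
  by rewrite /= [F j i]aF; ring.
by rewrite [X in _ + X]exchange_big /= -mulr2n mulr_natl.
Qed.

(** <R(e, v) v, e>: the sectional curvature of the plane of e and v, times the
    squared area of their parallelogram. *)
Definition sectional (e v : 'rV[R]_n) x : R :=
  \sum_i \sum_j e 0 i * v 0 j * \sum_k \sum_l e 0 k * v 0 l * riemann_low G i j l k x.

Lemma curvature_operator_wedge (e v : 'rV[R]_n) x : V x ->
  curvature_operator G x (e^T *m v - v^T *m e) (e^T *m v - v^T *m e) = sectional e v x.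
Proof.
move=> Vx.
have wE i j : (e^T *m v - v^T *m e) i j = e 0 i * v 0 j - e 0 j * v 0 i.
  by rewrite !mxE !big_ord1 !mxE [e 0 j * _]mulrC.
have -> : curvature_operator G x (e^T *m v - v^T *m e) (e^T *m v - v^T *m e) =
  4^-1 * \sum_i \sum_j (e 0 i * v 0 j - e 0 j * v 0 i) *
     (2 * \sum_k \sum_l e 0 k * v 0 l * riemann_low G i j l k x).
  congr (_ * _); apply: eq_bigr => i _; apply: eq_bigr => j _.
  rewrite -antisym_sum; last by move=> k l; exact: riemann_low_antisym_r.
  rewrite mulr_sumr; apply: eq_bigr => k _; rewrite mulr_sumr; apply: eq_bigr => l _.
  by rewrite !wE mulrA.
rewrite antisym_sum; last first.
  move=> i j; rewrite -mulrN -sumrN; congr (_ * _); apply: eq_bigr => k _.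
  rewrite -sumrN; apply: eq_bigr => l _.
  by rewrite riemann_low_antisym_l mulrN.
rewrite /sectional mulrA.
rewrite mulr_sumr; apply: eq_bigr => i _; rewrite mulr_sumr; apply: eq_bigr => j _.
by field.
Qed.

Lemma riemannE i j k l x : V x ->
  riemann G i j k l x = \sum_m invmx (G x) l m * riemann_low G i j k m x.
Proof.
move=> Vx.
transitivity (\sum_p (invmx (G x) *m G x) l p * riemann G i j k p x).
  rewrite (bigD1 l)//= mulVmx ?unitG// mxE eqxx mul1r big1 ?addr0// => p pl.
  by rewrite mxE eq_sym (negbTE pl) mul0r.
under eq_bigr do rewrite mxE mulr_suml.
rewrite exchange_big; apply: eq_bigr => m _; rewrite mulr_sumr.
by apply: eq_bigr => p _; rewrite mulrA.
Qed.

Lemma sum4_swap (F : 'I_n -> 'I_n -> 'I_n -> 'I_n -> R) :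
  \sum_i \sum_j \sum_k \sum_l F i j k l = \sum_k \sum_l \sum_i \sum_j F i j k l.
Proof.
rewrite pair_bigA/= [RHS]pair_bigA/=.
under eq_bigr do rewrite pair_bigA/=; under [RHS]eq_bigr do rewrite pair_bigA/=.
exact: exchange_big.
Qed.

(** Ric(v, v) is the trace, over the inverse metric, of the quadratic form
    e |-> <R(e, v) v, e>, which is the curvature operator at e /\ v. *)
Lemma ricci_ge0 x (v : 'I_n -> R) : V x -> posdef (G x) ->
  (forall w : 'M[R]_n, w^T = - w -> 0 <= curvature_operator G x w w) ->
  0 <= \sum_i \sum_j ricci G i j x * v i * v j.
Proof.
move=> Vx pG K0.
pose B : 'M[R]_n := \matrix_(b, l) \sum_i \sum_j v i * v j * riemann_low G l i j b x.
have -> : \sum_i \sum_j ricci G i j x * v i * v j = \tr (invmx (G x) *m B).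
  rewrite trace_mulE.
  transitivity (\sum_i \sum_j \sum_l \sum_b
      invmx (G x) l b * (v i * v j * riemann_low G l i j b x)).
    apply: eq_bigr => i _; apply: eq_bigr => j _.
    rewrite /ricci -mulrA mulr_suml; apply: eq_bigr => l _.
    rewrite riemannE// mulr_suml; apply: eq_bigr => b _; ring.
  rewrite sum4_swap; apply: eq_bigr => l _; apply: eq_bigr => b _.
  rewrite mxE mulr_sumr; apply: eq_bigr => i _; rewrite mulr_sumr.
  by [].
apply: trace_mul_ge0; first exact: posdef_invmx.
move=> e; pose v' : 'rV[R]_n := \row_j v j.
have -> : (e *m B *m e^T) 0 0 = sectional e v' x.
  rewrite [LHS]mxE; apply: eq_bigr => l _.
  rewrite [X in X * _]mxE [X in _ * X]mxE mulr_suml.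
  under [RHS]eq_bigr do rewrite mulr_sumr.
  rewrite [RHS]exchange_big; apply: eq_bigr => b _.
  rewrite mxE mulr_sumr mulr_suml; apply: eq_bigr => i _.
  rewrite mulr_sumr mulr_suml mulr_sumr; apply: eq_bigr => j _.
  by rewrite !mxE; ring.
rewrite -curvature_operator_wedge//; apply: K0.
by rewrite linearB/= !trmx_mul !trmxK opprB.
Qed.

End RicciSign.

(** * Gradient and Laplacian of a logarithm and at a maximum *)

Lemma derive_partials (R : realType) n (F : 'rV[R]_n -> R) x v : differentiable F x ->
  'D_v F x = \sum_i v 0 i * partial i F x.
Proof.
move=> dF; rewrite deriveE// [v in LHS]row_sum_delta linear_sum.
by apply: eq_bigr => i _; rewrite linearZ /partial deriveE.
Qed.

Section LocalMax.
Variables (R : realType) (n : nat) (V : set 'rV[R]_n).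
Hypothesis oV : open V.
Variable G : 'rV[R]_n -> 'M[R]_n.
Hypothesis sG : smooth_mx V G.
Hypothesis pG : forall x, V x -> posdef (G x).
Implicit Types (x : 'rV[R]_n) (F : 'rV[R]_n -> R).

Let symG x : V x -> (G x)^T = G x. Proof. by move=> /pG[]. Qed.
Let unitG x : V x -> G x \in unitmx. Proof. by move=> /pG/posdef_unitmx. Qed.

Lemma sqnorm_grad_sum F x : V x -> sqnorm_grad G F x =
  \sum_i \sum_j inv_metric G x i j * partial i F x * partial j F x.
Proof.
move=> Vx; rewrite (sqnorm_gradE symG unitG F Vx) mxE; apply: eq_bigr => i _.
rewrite [X in X * _]mxE [X in X * _]mxE [X in _ * X]mxE mulr_sumr.
apply: eq_bigr => j _; rewrite [du F x j 0]mxE.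
by move: (partial i F x) (partial j F x) => a b; ring.
Qed.

Lemma sqnorm_grad_pairing F x : V x ->
  sqnorm_grad G F x = \sum_i grad_col G F x i 0 * partial i F x.
Proof.
move=> Vx; rewrite (sqnorm_gradE symG unitG F Vx) mxE; apply: eq_bigr => i _.
by rewrite [X in X * _]mxE [X in X * _]mxE mulrC.
Qed.

Lemma smooth_christoffel k i j : smooth_on V (christoffel G k i j).
Proof.
apply: smooth_on_eq (smooth_Gamma oV sG unitG i j k) => // y _.
by rewrite mxE.
Qed.

Lemma smooth_laplacian F : smooth_on V F -> smooth_on V (laplacian G F).
Proof.
move=> sF; apply: smooth_on_sum => // i _; apply: smooth_on_sum => // j _.
apply: smooth_onM => //; first exact: (smooth_inv_metric oV sG unitG).
apply: smooth_onD => //; first by do 2 apply: smooth_partial.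
apply: smooth_onN => //; apply: smooth_on_sum => // k _; apply: smooth_onM => //.
  exact: smooth_christoffel.
exact: smooth_partial.
Qed.

Lemma smooth_sqnorm_grad F : smooth_on V F -> smooth_on V (sqnorm_grad G F).
Proof.
move=> sF; apply: (@smooth_on_eq _ _ V (fun x =>
  \sum_i \sum_j inv_metric G x i j * partial i F x * partial j F x)) => //.
  by move=> y Vy; rewrite sqnorm_grad_sum.
apply: smooth_on_sum => // i _; apply: smooth_on_sum => // j _.
apply: smooth_onM => //; last exact: smooth_partial.
by apply: smooth_onM => //; [exact: (smooth_inv_metric oV sG unitG)|exact: smooth_partial].
Qed.

Section Log.
Variable F : 'rV[R]_n -> R.
Hypothesis sF : smooth_on V F.
Hypothesis F_gt0 : forall x, V x -> 0 < F x.
Let u x := - ln (F x).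

Lemma partial_Nln i x : V x -> partial i u x = - (partial i F x / F x).
Proof.
move=> Vx; have slF := smooth_on_ln oV F_gt0 sF.
rewrite (partialN i slF Vx); congr (- _).
by apply: derive_ln; [exact: smooth_on_differentiable sF Vx|exact: F_gt0].
Qed.

Lemma sqnorm_grad_Nln x : V x -> sqnorm_grad G u x = sqnorm_grad G F x / F x ^+ 2.
Proof.
move=> Vx; have F0 := lt0r_neq0 (F_gt0 Vx).
rewrite !sqnorm_grad_sum// mulr_suml; apply: eq_bigr => i _.
rewrite mulr_suml; apply: eq_bigr => j _; rewrite !partial_Nln//.
move: (F x) (partial i F x) (partial j F x) F0 => a b c a0.
by field.
Qed.

Lemma partial2_Nln i j x : V x -> partial i (partial j u) x =
  - (partial i (partial j F) x / F x) + partial i F x * partial j F x / F x ^+ 2.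
Proof.
move=> Vx; have F0 := lt0r_neq0 (F_gt0 Vx).
have Fn0 y : V y -> F y != 0 by move=> /F_gt0/lt0r_neq0.
have sj := smooth_partial j sF; have sV := smooth_onV oV Fn0 sF.
rewrite (@partial_eq _ _ V oV i _ (fun y => - (partial j F y * (F y)^-1)) x _ Vx); last first.
  by move=> y Vy; exact: partial_Nln.
rewrite (partialN i (smooth_onM oV sj sV) Vx) (partialM i sj sV Vx).
have -> : partial i (fun y => (F y)^-1) x = - (F x ^- 2 * partial i F x).
  rewrite /partial deriveV//; last exact: smooth_on_derivable sF Vx.
  by rewrite scaleNr.
move: (F x) (partial i (partial j F) x) (partial i F x) (partial j F x) F0 => a b c d a0.
by field.
Qed.

Lemma laplacian_Nln x : V x ->
  sqnorm_grad G u x - laplacian G u x = laplacian G F x / F x.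
Proof.
move=> Vx; have F0 := lt0r_neq0 (F_gt0 Vx).
rewrite sqnorm_grad_sum// mulr_suml -sumrB; apply: eq_bigr => i _.
rewrite mulr_suml -sumrB; apply: eq_bigr => j _.
rewrite /hessian partial2_Nln// !partial_Nln//.
have -> : \sum_k christoffel G k i j x * partial k u x =
    - ((\sum_k christoffel G k i j x * partial k F x) / F x).
  rewrite mulr_suml -sumrN; apply: eq_bigr => k _; rewrite partial_Nln//.
  by rewrite mulrN mulrA.
rewrite -/(inv_metric G x).
move: (inv_metric G x i j) (\sum_k christoffel G k i j x * partial k F x).
move: (partial i F x) (partial j F x) (partial i (partial j F) x).
by move=> a b c d e; field.
Qed.

End Log.

Lemma laplacian_comb F F' (c d : R) x : smooth_on V F -> smooth_on V F' -> V x ->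
  laplacian G (fun y => c * F y - F' y + d) x = c * laplacian G F x - laplacian G F' x.
Proof.
move=> sF sF' Vx.
have comb i (K K' : 'rV[R]_n -> R) b y : smooth_on V K -> smooth_on V K' -> V y ->
    partial i (fun y => c * K y - K' y + b) y = c * partial i K y - partial i K' y + 0.
  move=> sK sK' Vy.
  have sc : smooth_on V (fun=> c : R) by exact: smooth_on_cst.
  have s1 : smooth_on V (fun y => c * K y) by exact: smooth_onM.
  have s2 : smooth_on V (fun y => - K' y) by exact: smooth_onN.
  rewrite (partialD i (smooth_onD oV s1 s2) (@smooth_on_cst _ _ V b) Vy).
  rewrite (partialD i s1 s2 Vy) (partialM i sc sK Vy) (partialN i sK' Vy).
  by rewrite !partial_cst mul0r add0r.
rewrite mulr_sumr -sumrB; apply: eq_bigr => i _.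
rewrite mulr_sumr -sumrB; apply: eq_bigr => j _.
have -> : hessian G (fun y => c * F y - F' y + d) i j x =
    c * hessian G F i j x - hessian G F' i j x.
  rewrite /hessian.
  rewrite (@partial_eq _ _ V oV i _ (fun y => c * partial j F y - partial j F' y + 0) x _ Vx).
    rewrite (comb i _ _ _ x (smooth_partial j sF) (smooth_partial j sF') Vx) addr0.
    have -> : \sum_k christoffel G k i j x * partial k (fun y => c * F y - F' y + d) x =
        c * (\sum_k christoffel G k i j x * partial k F x)
        - \sum_k christoffel G k i j x * partial k F' x.
      rewrite mulr_sumr -sumrB; apply: eq_bigr => k _.
      rewrite (comb k _ _ _ x sF sF' Vx).
      by move: (partial k F x) (partial k F' x) => a b; ring.
    move: (\sum_k christoffel G k i j x * partial k F x).
    move: (\sum_k christoffel G k i j x * partial k F' x).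
    move: (partial i (partial j F) x) (partial i (partial j F') x) => a b a' b'.
    by ring.
  by move=> y Vy; exact: comb.
by move: (hessian G F i j x) (hessian G F' i j x) => a b; ring.
Qed.

(** At an interior maximum the gradient vanishes, so the Laplacian is the trace
    of the matrix of second derivatives, which is negative semidefinite. *)
Lemma laplacian_at_max F x : smooth_on V F -> V x -> (forall y, V y -> F y <= F x) ->
  (forall i, partial i F x = 0) /\ laplacian G F x <= 0.
Proof.
move=> sF Vx maxF.
have D0 i : partial i F x = 0 by have [] := derive_at_max (delta_mx 0 i) oV sF Vx maxF.
split=> //.
pose B : 'M[R]_n := \matrix_(j, i) - partial i (partial j F) x.
have -> : laplacian G F x = - \tr (inv_metric G x *m B).
  rewrite trace_mulE -sumrN; apply: eq_bigr => i _; rewrite -sumrN; apply: eq_bigr => j _.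
  rewrite [B j i]mxE mulrN opprK; congr (_ * _).
  by rewrite /hessian big1 ?subr0// => k _; rewrite D0 mulr0.
rewrite oppr_le0; apply: trace_mul_ge0; first exact/posdef_invmx/pG.
move=> v; have [_] := derive_at_max v oV sF Vx maxF; rewrite -oppr_ge0.
congr (0 <= _).
have -> : 'D_v ('D_v F) x = \sum_j v 0 j * \sum_i v 0 i * partial i (partial j F) x.
  rewrite (@derive_eq_on _ _ V _ (fun y => \sum_j v 0 j * partial j F y) v x oV _ Vx).
    have sD : smooth_on V (fun y => \sum_j v 0 j * partial j F y).
      apply: smooth_on_sum => // j _; apply: smooth_onM => //; first exact: smooth_on_cst.
      exact: smooth_partial.
    rewrite (derive_partials _ (smooth_on_differentiable sD Vx)).
    under [RHS]eq_bigr do rewrite mulr_sumr; rewrite exchange_big/=.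
    apply: eq_bigr => i _; rewrite (partial_sum oV) => //; last first.
      move=> j _; apply: smooth_onM => //; first exact: smooth_on_cst.
      exact: smooth_partial.
    rewrite mulr_sumr; apply: eq_bigr => j _.
    rewrite (partialM i (@smooth_on_cst _ _ V (v 0 j)) (smooth_partial j sF) Vx).
    by rewrite partial_cst mul0r add0r; ring.
  by move=> y Vy; apply: derive_partials; exact: smooth_on_differentiable sF Vy.
under eq_bigr do rewrite mulr_sumr.
rewrite exchange_big/= -sumrN [RHS]mxE; apply: eq_bigr => i _.
rewrite [X in _ = X * _]mxE [X in _ = _ * X]mxE mulr_suml -sumrN.
apply: eq_bigr => j _; rewrite [B j i]mxE.
by move: (partial i (partial j F) x) => d; ring.
Qed.

End LocalMax.

(** * Independence of the chart *)

(** A bilinear form transforms by J and its inverse by the inverse of J, so pulling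
    the inverse back along J undoes the change. *)
Lemma congr_invmx (R : comUnitRingType) n (J g : 'M[R]_n) : g \in unitmx ->
  J *m g *m J^T \in unitmx -> J^T *m invmx (J *m g *m J^T) *m J = invmx g.
Proof.
move=> ug uJ; set B := J *m g *m J^T.
have uJ1 : J \in unitmx.
  by move: uJ; rewrite !unitmx_mul => /andP[/andP[]].
have BE : J *m (g *m (J^T *m invmx B *m J)) = J.
  by rewrite !mulmxA -/B mulmxV// mul1mx.
have gE : g *m (J^T *m invmx B *m J) = 1%:M.
  by rewrite -[LHS](mulKmx uJ1) BE mulVmx.
by rewrite -[LHS](mulKmx ug) gE mulmx1.
Qed.

Section ChartChange.
Variables (R : realType) (n : nat) (M : topologicalType) (A : smooth_atlas R n M).

Lemma cod_overlap_open (a b : chart A) : open (cod a `&` Defs.point a @^-1` dom b).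
Proof.
rewrite openE => x [cx bx]; apply: filterI.
  by apply: open_nbhs_nbhs; split=> //; exact: cod_open.
by apply: (point_continuous cx); apply: open_nbhs_nbhs; split => //; exact: dom_open.
Qed.

Lemma partial_chart_change (a b : chart A) (h : M -> R) x i :
  cod a x -> dom b (Defs.point a x) ->
  differentiable (h \o Defs.point b) (Defs.coord b (Defs.point a x)) ->
  partial i (h \o Defs.point a) x =
  \sum_k partial i (fun y => Defs.coord b (Defs.point a y) 0 k) x *
         partial k (h \o Defs.point b) (Defs.coord b (Defs.point a x)).
Proof.
move=> cx bx dh; pose phi y := Defs.coord b (Defs.point a y).
have Wx : (cod a `&` Defs.point a @^-1` dom b) x by [].
have dk k : differentiable (fun y => phi y 0 k) x.
  exact: smooth_on_differentiable (transition_smooth k) Wx.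
have dphi : differentiable phi x.
  have -> : phi = \sum_k (fun y => phi y 0 k *: (delta_mx 0 k : 'rV[R]_n)).
    apply/funext => y; rewrite fct_sumE; exact: row_sum_delta.
  by apply: differentiable_sum => k; exact: differentiableZl.
have -> : partial i (h \o Defs.point a) x = 'D_(delta_mx 0 i) ((h \o Defs.point b) \o phi) x.
  have ext y : (cod a `&` Defs.point a @^-1` dom b) y ->
      (h \o Defs.point a) y = ((h \o Defs.point b) \o phi) y.
    by move=> [cy dy] /=; rewrite /phi coordK.
  exact: (derive_eq_on _ (@cod_overlap_open a b) ext Wx).
rewrite deriveE; last exact: differentiable_comp.
rewrite diff_comp// /= -deriveE// -deriveE//.
rewrite derive_partials//; apply: eq_bigr => k _; congr (_ * _).
by rewrite derive_mx ?mxE//; exact: diff_derivable.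
Qed.

Variable g : tensor2 A.
Hypothesis metric_g : riemannian_metric g.

Lemma metric_posdef c x : cod c x -> posdef (g c x).
Proof.
by case: metric_g => gs gp _ cx; split=> [|v v0]; [exact: gs|exact: gp].
Qed.

(** The gradient norm does not depend on the chart: the Jacobian of the
    transition map cancels against its inverse in the inverse metric. *)
Lemma grad_normsq_chart (a b : chart A) (h : M -> R) p :
  smooth_on (cod b) (h \o Defs.point b) -> dom a p -> dom b p ->
  grad_normsq_at g a h p = grad_normsq_at g b h p.
Proof.
move=> sh ap bp.
have cx := coord_cod ap; have cy := coord_cod bp.
set x := Defs.coord a p in cx; set y := Defs.coord b p in cy.
have bx : dom b (Defs.point a x) by rewrite coordK.
have yE : Defs.coord b (Defs.point a x) = y by rewrite /x coordK.
have sym c z : cod c z -> (g c z)^T = g c z by move=> /metric_posdef[].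
have unt c z : cod c z -> g c z \in unitmx by move=> /metric_posdef/posdef_unitmx.
pose J : 'M[R]_n := \matrix_(i, k) partial i (fun z => Defs.coord b (Defs.point a z) 0 k) x.
have gE : g a x = J *m g b y *m J^T.
  apply/matrixP => i j; have [_ _ gt] := metric_g.
  rewrite (gt a b x i j cx bx) /= yE [RHS]mxE exchange_big/=; apply: eq_bigr => l _.
  rewrite [X in _ = X * _]mxE mulr_suml; apply: eq_bigr => k _.
  rewrite [J i k]mxE [J^T l j]mxE [J j l]mxE.
  by move: (partial i _ x) (partial j _ x) (g b y k l) => r s t; ring.
have dE : du (h \o Defs.point a) x = J *m du (h \o Defs.point b) y.
  apply/matrixP => i j; rewrite [LHS]mxE [RHS]mxE.
  rewrite (partial_chart_change i cx bx) yE; last exact: smooth_on_differentiable sh cy.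
  by apply: eq_bigr => k _; rewrite [J i k]mxE [du _ _ _ _]mxE.
apply: etrans (sqnorm_gradE (sym a) (unt a) (h \o Defs.point a) cx) _.
apply: etrans _ (esym (sqnorm_gradE (sym b) (unt b) (h \o Defs.point b) cy)).
rewrite /grad_col dE /inv_metric trmx_mul.
have uJ : J *m g b y *m J^T \in unitmx by rewrite -gE; exact: unt.
have := congr_invmx (unt b y cy) uJ; rewrite -gE => <-.
by rewrite !mulmxA.
Qed.

End ChartChange.

(** * Evolution of the gradient under the flow *)

(** At an end of the interval the chain rule is applied to a positive smooth
    extension, whose derivative is determined by the values on the interval. *)
Lemma is_derive_within_ln (R : realType) (E : normedModType R) (I : set R) (W : set E)
    (F : (R^o * E)%type -> R) (t : R) x l : I t -> W x ->
  ProperFilter (within I t^') ->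
  (forall z, space_time I W z -> 0 < F z) -> smooth_within (space_time I W) F ->
  is_derive_within I (fun s => F (s, x)) t l ->
  is_derive_within I (fun s => ln (F (s, x))) t (l / F (t, x)).
Proof.
move=> It Wx PF F0 sF dF; have Az : space_time I W (t, x) by [].
have [K [G [oK Kz sG FG G0]]] := smooth_within_shrink (@open_gt R 0) F0 sF Az.
have dG := smooth_on_differentiable sG Kz.
have oKt := near_time_slice oK Kz.
have nearF (h : R -> R) m : is_derive_within I (fun s => h (G (s, x))) t m ->
    is_derive_within I (fun s => h (F (s, x))) t m.
  apply: cvg_trans; apply: near_eq_cvg; rewrite (FG _ Az Kz).
  rewrite !near_withinE; near=> s => _ Is; rewrite FG//; near: s; exact: oKt.
have lE : l = 'D_((1, 0) : (R^o * E)%type) G (t, x).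
  by apply: (is_derive_within_unique PF dF); apply: (nearF id); exact: derive_time.
apply: nearF; rewrite lE (FG _ Az Kz) -derive_ln//; last exact: G0.
apply: (@derive_time _ _ (fun z => ln (G z))).
by apply: smooth_on_differentiable Kz; exact: smooth_on_ln.
Unshelve. all: by end_near. Qed.

Section Evolution.
Variables (R : realType) (n : nat) (M : topologicalType).
Variables (A : smooth_atlas R n M) (T : R) (g : R -> tensor2 A) (f : R -> M -> R).
Local Notation I := [set` `[0, T]].
Hypothesis T_gt0 : 0 < T.
Hypothesis g_smooth : smooth_metric_family I g.
Hypothesis g_flow : ricci_flow I g.
Hypothesis f_smooth : smooth_function_family A I f.
Hypothesis f_gt0 : forall (t : R) p, 0 <= t <= T -> 0 < f t p.
Hypothesis f_heat : backward_heat_equation I g f.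

Let inI (t : R) : 0 <= t <= T -> I t. Proof. by rewrite /= in_itv. Qed.

Definition nlog t p := - ln (f t p).
Definition nlog_chart (c : chart A) t := nlog t \o Defs.point c.

Variables (c : chart A) (x : 'rV[R]_n).
Hypothesis cx : cod c x.

Lemma flow_posdef t y : 0 <= t <= T -> cod c y -> posdef (g t c y).
Proof. by move=> tT; apply: metric_posdef; apply: g_smooth.1; exact: inI. Qed.

Let ST := space_time I (cod c).
Let oc : open (cod c) := @cod_open _ _ _ A c.

Lemma smooth_within_metric i j : smooth_within ST (fun z => g z.1 c z.2 i j).
Proof. exact: g_smooth.2. Qed.

Lemma smooth_within_f : smooth_within ST (fun z => f z.1 (Defs.point c z.2)).
Proof. exact: f_smooth. Qed.

Let STI (z : R^o * 'rV[R]_n) : ST z -> 0 <= z.1 <= T. Proof. by case; rewrite /= in_itv. Qed.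

Lemma smooth_within_nlog : smooth_within ST (fun z => nlog_chart c z.1 z.2).
Proof.
apply: smooth_withinN; apply: smooth_within_ln smooth_within_f.
by move=> z /STI; exact: f_gt0.
Qed.

Lemma smooth_within_inv_metric i j :
  smooth_within ST (fun z => inv_metric (g z.1 c) z.2 i j).
Proof.
apply: (@smooth_within_invmx _ _ _ _ (fun z => g z.1 c z.2)); last exact: smooth_within_metric.
by move=> z zST; apply: posdef_unitmx; apply: flow_posdef; [exact: STI|case: zST].
Qed.

Lemma smooth_within_sqnorm :
  smooth_within ST (fun z => sqnorm_grad (g z.1 c) (nlog_chart c z.1) z.2).
Proof.
apply: (@smooth_within_eq _ _ _ (fun z => \sum_i \sum_j inv_metric (g z.1 c) z.2 i j *
   partial i (nlog_chart c z.1) z.2 * partial j (nlog_chart c z.1) z.2)).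
  move=> z zST; rewrite (@sqnorm_grad_sum _ _ (cod c))//; last by case: zST.
  by move=> y cy; apply: flow_posdef cy; exact: STI.
have sp i : smooth_within ST (fun z => partial i (nlog_chart c z.1) z.2).
  exact: (smooth_within_space_derive (delta_mx 0 i) oc smooth_within_nlog).
apply: smooth_within_sum => i _; apply: smooth_within_sum => j _.
apply: smooth_withinM => //; apply: smooth_withinM => //.
exact: smooth_within_inv_metric.
Qed.

Variable t : R.
Hypothesis tT : 0 <= t <= T.

Lemma smooth_metric_at : smooth_mx (cod c) (g t c).
Proof.
by move=> i j; exact: (smooth_within_slice oc (inI tT) (smooth_within_metric i j)).
Qed.

Lemma smooth_f_at : smooth_on (cod c) (f t \o Defs.point c).
Proof. exact: (smooth_within_slice oc (inI tT) smooth_within_f). Qed.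

Lemma smooth_nlog_at : smooth_on (cod c) (nlog_chart c t).
Proof. exact: (smooth_within_slice oc (inI tT) smooth_within_nlog). Qed.

Let pG y : cod c y -> posdef (g t c y). Proof. exact: flow_posdef. Qed.
Let PF : ProperFilter (within I t^') := within_itv_proper T_gt0 tT.

(** Taking the logarithm turns the Laplacian of f into the Laplacian of u minus the
    quadratic term |grad u|^2. *)
Lemma nlog_evolution y : cod c y ->
  is_derive_within I (fun s => nlog_chart c s y) t
   (sqnorm_grad (g t c) (nlog_chart c t) y - laplacian (g t c) (nlog_chart c t) y).
Proof.
move=> cy.
have f0 z : cod c z -> 0 < (f t \o Defs.point c) z by move=> _; exact: f_gt0.
rewrite (laplacian_Nln oc pG smooth_f_at f0 cy) -[_ / _]opprK.
apply: is_derive_withinN; rewrite -mulNr.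
have fpos z : ST z -> 0 < f z.1 (Defs.point c z.2) by move=> /STI; exact: f_gt0.
apply: (is_derive_within_ln (inI tT) cy PF fpos smooth_within_f).
have := f_heat (inI tT) (point_dom cy).
by rewrite /laplacian_at pointK.
Qed.

Let N := inv_metric (g t c) x.
Let v := grad_col (g t c) (nlog_chart c t) x.

(** Obtained by differentiating N G = 1 in time, the flow giving the derivative of G. *)
Lemma inv_metric_evolution : exists2 dN : 'M[R]_n,
  (forall i j, is_derive_within I (fun s => inv_metric (g s c) x i j) t (dN i j)) &
  dN = 2 *: (N *m (\matrix_(i, j) ricci (g t c) i j x) *m N).
Proof.
have ex i j := smooth_within_time_derivable (inI tT) cx (smooth_within_inv_metric i j).
pose dN : 'M[R]_n := \matrix_(i, j) sval (cid (ex i j)).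
have dNP i j : is_derive_within I (fun s => inv_metric (g s c) x i j) t (dN i j).
  by rewrite mxE; exact: svalP (cid (ex i j)).
exists dN => //.
pose Ric : 'M[R]_n := \matrix_(i, j) ricci (g t c) i j x.
have dG i j : is_derive_within I (fun s => g s c x i j) t (- 2 * ricci (g t c) i j x).
  exact: (@g_flow t c x i j (inI tT) cx).
have NG : dN *m g t c x = 2 *: (N *m Ric).
  apply/matrixP => i j; apply/eqP; rewrite -subr_eq0; apply/eqP.
  have d1 : is_derive_within I (fun s => \sum_k inv_metric (g s c) x i k * g s c x k j) t
      (\sum_k (dN i k * g t c x k j + N i k * (- 2 * ricci (g t c) k j x))).
    by apply: is_derive_within_sum => k _; apply: is_derive_withinM.
  have d0 : is_derive_within I (fun s => \sum_k inv_metric (g s c) x i k * g s c x k j) t 0.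
    apply: is_derive_within_eq (is_derive_within_cst I t ((1%:M : 'M[R]_n) i j)).
      exact: inI.
    move=> s; rewrite /= in_itv/= => sT.
    have us : g s c x \in unitmx by apply: posdef_unitmx; exact: flow_posdef.
    by rewrite -(mulVmx us) mxE.
  apply: etrans _ (is_derive_within_unique PF d1 d0).
  rewrite [X in X - _]mxE [X in _ - X]mxE [X in _ - _ * X]mxE mulr_sumr -sumrB.
  by apply: eq_bigr => k _; rewrite [Ric k j]mxE; ring.
have uG : g t c x \in unitmx by apply: posdef_unitmx; exact: pG.
by rewrite -[LHS](mulmxK uG) NG -scalemxAl.
Qed.

(** The components of grad u are space derivatives of u, so their time derivatives
    are space derivatives of |grad u|^2 - Lap u. *)
Lemma sqnorm_evolution :
  is_derive_within I (fun s => sqnorm_grad (g s c) (nlog_chart c s) x) t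
   (2 * \sum_i \sum_j ricci (g t c) i j x * v i 0 * v j 0
    + 2 * \sum_i v i 0 * (partial i (sqnorm_grad (g t c) (nlog_chart c t)) x
                          - partial i (laplacian (g t c) (nlog_chart c t)) x)).
Proof.
have [dN dNP dNE] := inv_metric_evolution.
pose w y := sqnorm_grad (g t c) (nlog_chart c t) y - laplacian (g t c) (nlog_chart c t) y.
have dh i : is_derive_within I (fun s => partial i (nlog_chart c s) x) t (partial i w x).
  exact: (@time_space_derive_comm _ _ I (cod c) (fun z => nlog_chart c z.1 z.2) t x
    (delta_mx 0 i) w oc (inI tT) cx PF smooth_within_nlog nlog_evolution).
have sP : smooth_on (cod c) (sqnorm_grad (g t c) (nlog_chart c t)).
  exact: (smooth_sqnorm_grad oc smooth_metric_at pG smooth_nlog_at).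
have sL : smooth_on (cod c) (laplacian (g t c) (nlog_chart c t)).
  exact: (smooth_laplacian oc smooth_metric_at pG smooth_nlog_at).
have wE i : partial i w x = partial i (sqnorm_grad (g t c) (nlog_chart c t)) x
                          - partial i (laplacian (g t c) (nlog_chart c t)) x.
  by rewrite (partialD i sP (smooth_onN oc sL) cx) (partialN i sL cx).
apply: (@is_derive_within_eq _ _ (fun s => \sum_i \sum_j inv_metric (g s c) x i j *
   partial i (nlog_chart c s) x * partial j (nlog_chart c s) x)).
- exact: inI.
- move=> s; rewrite /= in_itv/= => sT.
  by rewrite (@sqnorm_grad_sum _ _ (cod c))// => y cy; exact: flow_posdef.
pose Ric : 'M[R]_n := \matrix_(i, j) ricci (g t c) i j x.
pose h_col := du (nlog_chart c t) x.
pose h i := partial i (nlog_chart c t) x.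
have sN : N^T = N.
  have [] := posdef_invmx (pG cx); by [].
have vE i : v i 0 = \sum_j N i j * h j.
  by rewrite mxE; apply: eq_bigr => j _; rewrite mxE.
have vE' i : v i 0 = \sum_j N j i * h j.
  by rewrite vE; apply: eq_bigr => j _; rewrite -[in LHS]sN mxE.
have tot : is_derive_within I (fun s => \sum_i \sum_j inv_metric (g s c) x i j *
   partial i (nlog_chart c s) x * partial j (nlog_chart c s) x) t
  (\sum_i \sum_j ((dN i j * h i + N i j * partial i w x) * h j +
     N i j * h i * partial j w x)).
  apply: is_derive_within_sum => i _; apply: is_derive_within_sum => j _.
  by apply: is_derive_withinM => //; apply: is_derive_withinM.
have -> : 2 * \sum_i \sum_j ricci (g t c) i j x * v i 0 * v j 0
    + 2 * \sum_i v i 0 * (partial i (sqnorm_grad (g t c) (nlog_chart c t)) x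
                          - partial i (laplacian (g t c) (nlog_chart c t)) x) =
  \sum_i \sum_j ((dN i j * h i + N i j * partial i w x) * h j +
     N i j * h i * partial j w x).
  have <- : \sum_i v i 0 * partial i w x = \sum_i v i 0 *
      (partial i (sqnorm_grad (g t c) (nlog_chart c t)) x
       - partial i (laplacian (g t c) (nlog_chart c t)) x).
    by apply: eq_bigr => i _; rewrite wE.
  have -> : \sum_i \sum_j ((dN i j * h i + N i j * partial i w x) * h j +
      N i j * h i * partial j w x) = \sum_i \sum_j dN i j * h i * h j +
    (\sum_i \sum_j N i j * h j * partial i w x + \sum_i \sum_j N i j * h i * partial j w x).
    rewrite -!big_split; apply: eq_bigr => i _; rewrite -!big_split.
    apply: eq_bigr => j _ /=.
    move: (dN i j) (h i) (N i j) (partial i w x) (h j) (partial j w x).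
    by move=> d hi nij wi hj wj; ring.
  congr (_ + _).
    transitivity (((h_col^T *m dN) *m h_col) 0 0); last first.
      rewrite mxE exchange_big; apply: eq_bigr => j _.
      rewrite mxE mulr_suml.
      apply: eq_bigr => i _; rewrite [h_col^T _ _]mxE [h_col i 0]mxE [h_col j 0]mxE.
      by rewrite -/(h i) -/(h j) [h i * _]mulrC.
    rewrite dNE -scalemxAr -scalemxAl mxE; congr (_ * _).
    have -> : h_col^T *m (N *m Ric *m N) *m h_col = v^T *m Ric *m v.
      by rewrite trmx_mul -/N sN !mulmxA.
    rewrite mxE exchange_big; apply: eq_bigr => j _.
    rewrite [X in _ = X * _]mxE mulr_suml.
    apply: eq_bigr => i _; rewrite [v^T _ _]mxE [Ric _ _]mxE.
    by move: (v i 0) (v j 0) (ricci (g t c) i j x) => a b r; ring.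
  apply: etrans (mulr_natl _ 2) _; apply: etrans (mulr2n _) _.
  apply: (congr2 +%R).
    apply: eq_bigr => i _; apply: etrans _ (mulr_suml _ _ _ _).
    exact: (congr1 (fun z => z * partial i w x) (vE i)).
  apply: etrans _ (exchange_big _ _ _ _ _ _).
  apply: eq_bigr => i _; apply: etrans _ (mulr_suml _ _ _ _).
  exact: (congr1 (fun z => z * partial i w x) (vE' i)).
exact: tot.
Qed.

End Evolution.

(** * Maximum principle *)

(** The interval extends to the right of t, which gives the sign of one-sided
    difference quotients even at t = 0. *)
Lemma is_derive_within_at_max (R : realType) (T t : R) (F : R -> R) l : 0 <= t < T ->
  (forall s, 0 <= s <= T -> F s <= F t) ->
  is_derive_within `[0, T] F t l -> l <= 0.
Proof.
move=> /andP[t0 tT] Fmax dF; rewrite leNgt; apply/negP => l0.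
have /nbhs_ballP[e /= e0 He] := dF _ (open_nbhs_nbhs (conj (@open_gt R 0) l0)).
pose s := Num.min (t + e / 2) T.
have ts : t < s by rewrite lt_min tT andbT ltrDl divr_gt0.
have sT : 0 <= s <= T by rewrite (le_trans t0 (ltW ts)) ge_min lexx orbT.
have : 0 < (F s - F t) / (s - t).
  apply: (He s) => /=; last by rewrite in_itv.
    rewrite -ball_normE/= distrC gtr0_norm ?subr_gt0// ltrBlDl gt_min.
    by rewrite ltrD2l ltr_pdivrMr// ltr_pMr// ltr1n.
  by rewrite gt_eqF.
by rewrite pmulr_lgt0 ?invr_gt0 ?subr_gt0// ltNge Fmax.
Qed.

Section MaximumPrinciple.
Variables (R : realType) (n : nat) (M : topologicalType).
Variables (A : smooth_atlas R n M) (T : R) (g : R -> tensor2 A) (f : R -> M -> R).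
Local Notation I := [set` `[0, T]].
Hypothesis T_gt0 : 0 < T.
Hypothesis g_smooth : smooth_metric_family I g.
Hypothesis g_flow : ricci_flow I g.
Hypothesis g_curv : forall t : R, 0 <= t <= T -> nonneg_curvature_operator (g t).
Hypothesis f_smooth : smooth_function_family A I f.
Hypothesis f_gt0 : forall (t : R) p, 0 <= t <= T -> 0 < f t p.
Hypothesis f_heat : backward_heat_equation I g f.

(** psi + e (t - T) in the chart c.  The last term vanishes at time T and makes the
    evolution inequality strict. *)
Definition harnack e c t x : R :=
  (T - t) * sqnorm_grad (g t c) (nlog_chart f c t) x - nlog_chart f c t x + e * (t - T).

(** Where grad psi = 0 the sum of the time derivative and the Laplacian of
    psi + e (t - T) is at least e, whereas both are nonpositive at a maximum. *)
Lemma harnack_no_max e c t x : 0 < e -> 0 <= t < T -> cod c x ->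
  (forall y, cod c y -> harnack e c t y <= harnack e c t x) ->
  (forall s, 0 <= s <= T -> harnack e c s x <= harnack e c t x) -> False.
Proof.
move=> e0 tT cx max_x max_t.
(* In the sum of the two inequalities SL cancels, and s SP = P removes P. *)
have arith (s P L tr Ric SP SL a : R) : 0 < e -> 0 <= s * tr -> 0 <= s * Ric ->
    s * SP = P -> s * (2 * tr + 2 * SL + 2 * Ric) - L <= 0 ->
    (0 - 1) * P + s * (2 * Ric + 2 * (SP - SL)) - (P - L) + (0 * a + e * (1 + - 0)) <= 0 ->
    False.
  by move=> e1 h1 h2 h3 h4 h5; lra.
have tT' : 0 <= t <= T by case/andP: tT => -> /ltW.
have oc := @cod_open _ _ _ A c.
pose G := g t c; pose U := nlog_chart f c t.
have pG y (cy : cod c y) : posdef (G y) := flow_posdef g_smooth tT' cy.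
have symG y (cy : cod c y) : (G y)^T = G y := (pG y cy).1.
have unitG y (cy : cod c y) : G y \in unitmx := posdef_unitmx (pG y cy).
have sG : smooth_mx (cod c) G := smooth_metric_at g_smooth tT'.
have sU : smooth_on (cod c) U := smooth_nlog_at f_smooth f_gt0 tT'.
have sP : smooth_on (cod c) (sqnorm_grad G U) := smooth_sqnorm_grad oc sG pG sU.
pose v := grad_col G U x.
pose tr := \tr (inv_metric G x *m (hess G U x *m inv_metric G x *m hess G U x)).
pose Ric := \sum_i \sum_j ricci G i j x * v i 0 * v j 0.
pose SL := \sum_i v i 0 * partial i (laplacian G U) x.
pose SP := \sum_i v i 0 * partial i (sqnorm_grad G U) x.
have tr0 : 0 <= tr.
  apply: trace_mul_ge0; first exact: posdef_invmx (pG x cx).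
  move=> w; have pI := posdef_psd (posdef_invmx (pG x cx)) (w *m hess G U x).
  move: pI; congr (0 <= fun_of_matrix _ 0 0).
  by rewrite trmx_mul (hess_sym oc symG sU cx) !mulmxA.
have Ric0 : 0 <= Ric.
  apply: (ricci_ge0 oc sG symG unitG (fun i => v i 0) cx (pG x cx)) => w.
  exact: (g_curv tT' cx).
have [D0 L0] : (forall i, partial i (harnack e c t) x = 0) /\
    laplacian G (harnack e c t) x <= 0.
  apply: (laplacian_at_max oc pG) => //.
  apply: smooth_onD => //; last exact: smooth_on_cst.
  apply: smooth_onD => //; last exact: smooth_onN.
  by apply: smooth_onM => //; exact: smooth_on_cst.
have gradE i : (T - t) * partial i (sqnorm_grad G U) x = partial i U x.
  have sc : smooth_on (cod c) (fun=> T - t : R) by exact: smooth_on_cst.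
  have s1 := smooth_onM oc sc sP; have s2 := smooth_onN oc sU.
  have := D0 i; rewrite /harnack.
  rewrite (partialD i (smooth_onD oc s1 s2) (@smooth_on_cst _ _ _ (e * (t - T))) cx).
  rewrite (partialD i s1 s2 cx) (partialM i sc sP cx) (partialN i sU cx) !partial_cst.
  rewrite mul0r add0r addr0 => /eqP; rewrite subr_eq0 => /eqP; exact.
have SPE : (T - t) * SP = sqnorm_grad G U x.
  rewrite (sqnorm_grad_pairing pG U cx) mulr_sumr; apply: eq_bigr => i _.
  by rewrite -gradE mulrCA.
move: L0; rewrite /harnack (laplacian_comb oc G _ _ sP sU cx).
rewrite (bochner oc sG symG unitG sU cx) -/tr -/SL -/Ric => L0.
have dl : is_derive_within I (fun s => harnack e c s x) t
   ((0 - 1) * sqnorm_grad G U x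
    + (T - t) * (2 * Ric + 2 * (SP - SL))
    - (sqnorm_grad G U x - laplacian G U x) + (0 * (t - T) + e * (1 + - 0))).
  apply: is_derive_withinD.
    apply: is_derive_withinD.
      apply: is_derive_withinM.
        apply: is_derive_withinD; first exact: is_derive_within_cst.
        by apply: is_derive_withinN; exact: is_derive_within_id.
      have := sqnorm_evolution T_gt0 g_smooth g_flow f_smooth f_gt0 f_heat cx tT'.
      congr (is_derive_within _ _ _ (_ + 2 * _)).
      by rewrite -sumrB; apply: eq_bigr => i _; rewrite mulrBr.
    apply: is_derive_withinN.
    exact: (nlog_evolution T_gt0 g_smooth f_smooth f_gt0 f_heat tT' cx).
  apply: is_derive_withinM; first exact: is_derive_within_cst.
  apply: is_derive_withinD; first exact: is_derive_within_id.
  by apply: is_derive_withinN; exact: is_derive_within_cst.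
have H := is_derive_within_at_max tT max_t dl.
have tau0 : 0 <= T - t by rewrite subr_ge0; case/andP: tT'.
exact: (arith _ _ _ _ _ _ _ _ e0 (mulr_ge0 tau0 tr0) (mulr_ge0 tau0 Ric0) SPE L0 H).
Qed.

End MaximumPrinciple.

Lemma smooth_on_fst (R : realType) (E : normedModType R) :
  smooth_on setT (fun z : (R^o * E)%type => z.1 : R).
Proof.
have cfst : continuous (fst : (R^o * E)%type -> R^o) by move=> z; exact: cvg_fst.
have dfst z : differentiable (fst : (R^o * E)%type -> R^o) z.
  exact: linear_differentiable.
apply/smooth_onP => -[|k] /=; first by move=> z _; exact: dfst.
split=> [z _|v]; first exact: dfst.
have /smooth_onP/(_ k) := @smooth_on_cst R (R^o * E)%type setT v.1.
apply: diff_upto_eq => [|z _]; first exact: openT.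
by rewrite deriveE; [rewrite diff_lin|exact: dfst].
Qed.

Section GlobalMaximum.
Variables (R : realType) (n : nat) (M : topologicalType).
Variables (A : smooth_atlas R n M) (T : R) (g : R -> tensor2 A) (f : R -> M -> R).
Local Notation I := [set` `[0, T]].
Hypothesis M_compact : compact [set: M].
Hypothesis T_gt0 : 0 < T.
Hypothesis g_smooth : smooth_metric_family I g.
Hypothesis g_flow : ricci_flow I g.
Hypothesis g_curv : forall t : R, 0 <= t <= T -> nonneg_curvature_operator (g t).
Hypothesis f_smooth : smooth_function_family A I f.
Hypothesis f_gt0 : forall (t : R) p, 0 <= t <= T -> 0 < f t p.
Hypothesis f_lt1 : forall (t : R) p, 0 <= t <= T -> f t p < 1.
Hypothesis f_heat : backward_heat_equation I g f.

Definition chart_at (p : M) : chart A := sval (cid (@dom_cover _ _ _ A p)).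

Definition harnack_at e (t : R) p : R :=
  harnack T g f e (chart_at p) t (Defs.coord (chart_at p) p).

Lemma dom_chart_at p : dom (chart_at p) p.
Proof. exact: svalP (cid (@dom_cover _ _ _ A p)). Qed.

Lemma harnack_chart (e t : R) c p : 0 <= t <= T -> dom c p ->
  harnack_at e t p = harnack T g f e c t (Defs.coord c p).
Proof.
move=> tT cp; have dp := dom_chart_at p.
have It : I t by rewrite /= in_itv.
have nlogE (a : chart A) : dom a p -> nlog_chart f a t (Defs.coord a p) = nlog f t p.
  by move=> ap; rewrite /nlog_chart /= coordK.
have sE : grad_normsq_at (g t) (chart_at p) (nlog f t) p =
    grad_normsq_at (g t) c (nlog f t) p.
  apply: (grad_normsq_chart (g_smooth.1 t It) _ dp cp).
  exact: (smooth_nlog_at f_smooth f_gt0 tT).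
rewrite /harnack_at /harnack (nlogE _ dp) (nlogE _ cp).
exact: (congr1 (fun q => (T - t) * q - nlog f t p + e * (t - T)) sE).
Qed.

Lemma harnack_continuous e : {within I `*` [set: M],
  continuous (fun z : R * M => harnack_at e z.1 z.2)}.
Proof.
apply/subspace_continuousP => -[t p] [/= It _].
have tT : 0 <= t <= T by move: It; rewrite in_itv.
pose c := chart_at p; have cp : dom c p := dom_chart_at p.
have oc := @cod_open _ _ _ A c.
pose F (z : (R^o * 'rV[R]_n)%type) := harnack T g f e c z.1 z.2.
have sF : smooth_within (space_time I (cod c)) F.
  have st : smooth_within (space_time I (cod c)) (fun z => z.1 : R).
    move=> z _; exists setT, (fun z => z.1); split => //; first exact: openT.
    exact: smooth_on_fst.
  apply: smooth_withinD.
    apply: smooth_withinD.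
      apply: smooth_withinM.
        by apply: smooth_withinD; [exact: smooth_within_cst|exact: smooth_withinN].
      exact: (@smooth_within_sqnorm _ _ _ _ T g f g_smooth f_smooth f_gt0 c).
    apply: smooth_withinN.
    exact: (@smooth_within_nlog _ _ _ _ T f f_smooth f_gt0 c).
  apply: smooth_withinM; first exact: smooth_within_cst.
  by apply: smooth_withinD => //; exact: smooth_within_cst.
have Fz : space_time I (cod c) (t, Defs.coord c p) by split=> //=; exact: coord_cod.
have zE : harnack_at e t p = F (t, Defs.coord c p) := harnack_chart e tT cp.
move=> P FP; have {}FP : nbhs (F (t, Defs.coord c p)) P by rewrite -zE.
have [B nB BP] : exists2 B : set (R^o * 'rV[R]_n), nbhs (t, Defs.coord c p) B &
    forall y, B y -> space_time I (cod c) y -> P (F y).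
  by have H := smooth_within_continuous sF Fz FP; exists (fun y => space_time I (cod c) y -> P (F y)).
have cj : ((z.1, Defs.coord c z.2) : (R^o * 'rV[R]_n)%type) @[z --> nbhs (t, p)]
    --> ((t, Defs.coord c p) : (R^o * 'rV[R]_n)%type).
  have c1 : z.1 @[z --> nbhs (t, p)] --> nbhs t by exact: cvg_fst.
  have c2 : Defs.coord c z.2 @[z --> nbhs (t, p)] --> nbhs (Defs.coord c p).
    have cs : z.2 @[z --> nbhs (t, p)] --> nbhs p by exact: cvg_snd.
    by move=> Q nQ; apply: (cs (Defs.coord c @^-1` Q)); exact: (Defs.coord_continuous cp nQ).
  exact: (cvg_pair c1 c2).
have nd : \forall z \near (t, p), dom c z.2.
  have cs : z.2 @[z --> nbhs (t, p)] --> nbhs p by exact: cvg_snd.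
  by apply: cs; apply: open_nbhs_nbhs; split => //; exact: dom_open.
suff: \forall z \near (t, p), (I `*` [set: M]) z -> P (harnack_at e z.1 z.2) by [].
near=> z => -[Iz _].
have dz : dom c z.2 by near: z.
have zT : 0 <= z.1 <= T by move: Iz; rewrite /= in_itv.
rewrite (harnack_chart e zT dz).
apply: (BP (z.1, Defs.coord c z.2)); last by split=> //=; exact: coord_cod.
by near: z; exact: (cj _ nB).
Unshelve. all: by end_near. Qed.

(** At time T the quantity is - u, and no maximum occurs earlier. *)
Lemma harnack_le0 (e t : R) p : 0 < e -> 0 <= t <= T -> harnack_at e t p <= 0.
Proof.
move=> e0 tT.
have K0 : (I `*` [set: M]) !=set0 by exists (t, p); split => //=; rewrite in_itv.
have cK : compact (I `*` [set: M]).
  by apply: compact_setX => //; exact: segment_compact.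
have [[t0 p0]] := compact_EVT_max K0 cK (@harnack_continuous e).
rewrite inE => -[/= It0 _] zmax.
have tT0 : 0 <= t0 <= T by move: It0; rewrite in_itv.
have max0 s q : 0 <= s <= T -> harnack_at e s q <= harnack_at e t0 p0.
  by move=> sT; apply: (zmax (s, q)); rewrite inE; split => //=; rewrite in_itv.
apply: le_trans (max0 t p tT) _.
have [t0T|t0T] := ltP t0 T; last first.
  have -> : t0 = T by apply/eqP; rewrite eq_le t0T andbT; case/andP: tT0.
  rewrite /harnack_at /harnack !subrr mul0r mulr0 addr0 add0r oppr_le0.
  rewrite /nlog_chart /= /nlog oppr_ge0 ln_le0// ltW//; apply: f_lt1.
  by rewrite ltW//= lexx.
pose c := chart_at p0; have cp : dom c p0 := dom_chart_at p0.
exfalso; apply: (@harnack_no_max _ _ _ A T g f T_gt0 g_smooth g_flow g_curv f_smooth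
  f_gt0 f_heat e c t0 (Defs.coord c p0) e0).
- by rewrite t0T andbT; case/andP: tT0.
- exact: coord_cod.
- move=> y cy; have := max0 t0 (Defs.point c y) tT0.
  rewrite (harnack_chart e tT0 cp) (harnack_chart e tT0 (point_dom cy)).
  by rewrite pointK.
- move=> s sT; have := max0 s p0 sT.
  by rewrite (harnack_chart e tT0 cp) (harnack_chart e sT cp).
Qed.

End GlobalMaximum.

Theorem theorem5p1 (R : realType) (n : nat) (M : topologicalType)
    (A : smooth_atlas R n M) (T : R) (g : R -> tensor2 A) (f : R -> M -> R)
    (M_hausdorff : hausdorff_space M)
    (M_compact : compact [set: M])
    (T_gt0 : 0 < T)
    (g_smooth : smooth_metric_family `[0, T] g)
    (g_flow : ricci_flow `[0, T] g)
    (g_curv : forall t, 0 <= t <= T -> nonneg_curvature_operator (g t))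
    (f_smooth : smooth_function_family A `[0, T] f)
    (f_gt0 : forall t p, 0 <= t <= T -> 0 < f t p)
    (f_lt1 : forall t p, 0 <= t <= T -> f t p < 1)
    (f_heat : backward_heat_equation `[0, T] g f) :
  let u t p := - ln (f t p) in
  let tau t := T - t in
  let H t c p := grad_normsq_at (g t) c (u t) p - u t p / tau t in
  forall t c p, 0 <= t < T -> dom c p ->
    H t c p <= 0 /\
    grad_normsq_at (g t) c (f t) p <= f t p ^+ 2 * ln (1 / f t p) / (T - t).
Proof.
move=> u tau H t c p tT cp.
have tT' : 0 <= t <= T by case/andP: tT => -> /ltW.
have tau0 : 0 < T - t by rewrite subr_gt0; case/andP: tT.
have oc := @cod_open _ _ _ A c; have cx := coord_cod cp.
have pG y (cy : cod c y) : posdef (g t c y) := flow_posdef g_smooth tT' cy.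
have uE : nlog_chart f c t (Defs.coord c p) = u t p.
  by rewrite /nlog_chart /= coordK.
pose P := grad_normsq_at (g t) c (u t) p.
have key : (T - t) * P <= u t p.
  apply/ler_addgt0Pr => e e0; rewrite -lerBlDl.
  have e'0 : 0 < e / (T - t) by rewrite divr_gt0.
  have := harnack_le0 M_compact T_gt0 g_smooth g_flow g_curv f_smooth f_gt0 f_lt1 f_heat
    p e'0 tT'.
  rewrite (harnack_chart g_smooth f_smooth f_gt0 _ tT' cp) /harnack uE.
  have -> : e / (T - t) * (t - T) = - e by field; rewrite gt_eqF.
  by rewrite subr_le0.
have Pu : P <= u t p / (T - t) by rewrite ler_pdivlMr// mulrC.
split; first by rewrite subr_le0.
have ft0 := f_gt0 t p tT'.
have f0 y : cod c y -> 0 < (f t \o Defs.point c) y by move=> _; exact: f_gt0.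
have PE : P = grad_normsq_at (g t) c (f t) p / f t p ^+ 2.
  have := sqnorm_grad_Nln oc pG (smooth_f_at f_smooth tT') f0 cx.
  by rewrite /= coordK.
rewrite div1r lnV ?posrE// -mulrA -ler_pdivrMl ?exprn_gt0//.
by rewrite mulrC -PE.
Qed.
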